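(* For every constant $b$, $\mathrm{MI}_b \le_m^p \mathrm{GMI}$, i.e. $\mathrm{MI}_b$ is polynomial-time many-one reducible to $\mathrm{GMI}$.
   Context: A matroid is a pair $(S,\mathcal{I})$ with $S$ finite and $\mathcal{I}$ a nonempty family of subsets of $S$ closed under subsets and satisfying the exchange axiom; its rank is the size of a maximal independent set. Two matroids are isomorphic if there is a bijection between ground sets mapping circuits (minimal dependent sets) exactly onto circuits. $\mathrm{MI}_b$: given two matroids of rank at most $b$ by independent-set oracles, decide whether they are isomorphic. For a graph $X=(V,E)$, $M(X)$ is its graphic matroid on $E$ whose circuits are edge sets of simple cycles; $\mathrm{GMI}$: given two graphs $X_1,X_2$, decide whether $M(X_1)\cong M(X_2)$. *)

(* Defs.v *)
From mathcomp Require Import all_boot ssralg poly.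

Set Implicit Arguments.
Unset Strict Implicit.
Unset Printing Implicit Defensive.

Record matroid (T : finType) := Matroid {
  indep : {set {set T}};
  indep_neq0 : indep != set0;
  indep_sub : forall A B : {set T}, A \subset B -> B \in indep -> A \in indep;
  indep_exchange : forall A B : {set T},
    A \in indep -> B \in indep -> #|A| < #|B| ->
    exists2 x, x \in B :\: A & x |: A \in indep }.

Definition rank (T : finType) (M : matroid T) : nat :=
  \max_(A in indep M) #|A|.

Definition circuit (T : finType) (M : matroid T) (C : {set T}) : bool :=
  minset [pred A | A \notin indep M] C.

Definition matroid_iso (T1 T2 : finType) (M1 : matroid T1) (M2 : matroid T2) :
    Prop :=
  exists2 f : T1 -> T2, bijective f
    & forall C : {set T1}, circuit M1 C <-> circuit M2 (f @: C).

Record sgraph := SGraph {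
  nv : nat;
  edges : {set {set 'I_nv}};
  edges_card2 : forall e, e \in edges -> #|e| = 2 }.

Section Graphic.
Variable X : sgraph.
Notation V := 'I_(nv X).

Definition edge : finType := {e : {set V} | e \in edges X}.

Definition adj (u v : V) : bool := [set u; v] \in edges X.

Definition simple_cycle (c : seq V) : bool :=
  [&& 2 < size c, uniq c & cycle adj c].

Definition cycle_edges (c : seq V) : {set edge} :=
  [set e : edge | [exists x, (x \in c) && (val e == [set x; next c x])]].

(* The length bound only serves to keep this boolean: see [is_cycleP]. *)
Definition is_cycle (C : {set edge}) : bool :=
  [exists k : 'I_(nv X).+1, exists c : k.-tuple V,
     simple_cycle c && (C == cycle_edges c)].

Definition forests : {set {set edge}} :=
  [set F : {set edge} | ~~ [exists C : {set edge}, is_cycle C && (C \subset F)]].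

Lemma is_cycleP (C : {set edge}) :
  reflect (exists2 c, simple_cycle c & C = cycle_edges c) (is_cycle C).
Proof.
apply: (iffP existsP) => [[k /existsP[c /andP[cc /eqP->]]]|[c cc ->]].
  by exists c.
have szc : size c < (nv X).+1.
  case/and3P: cc => _ cu _; by rewrite ltnS -(card_uniqP cu) (leq_trans (max_card _)) ?card_ord.
exists (Ordinal szc); apply/existsP; exists (in_tuple c) => /=.
by rewrite cc eqxx.
Qed.

Definition joins (F : {set edge}) : rel V :=
  fun u v => [exists e, (e \in F) && (val e == [set u; v])].

Implicit Types (F G : {set edge}) (e : edge) (u v : V).

Lemma joinsP F u v :
  reflect (exists2 e, e \in F & val e = [set u; v]) (joins F u v).
Proof.
by apply: (iffP existsP) => [[e /andP[eF /eqP ?]]|[e eF ev]]; exists e;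
  rewrite ?eF ?ev ?eqxx.
Qed.

Lemma joins_sym F u v : joins F u v = joins F v u.
Proof. by rewrite /joins setUC. Qed.

Lemma joins_connect_sym F : connect_sym (joins F).
Proof. by apply: sym_connect_sym; exact: joins_sym. Qed.

Lemma joinsS F G : F \subset G -> subrel (joins F) (joins G).
Proof.
by move=> FG u v /joinsP[e /(subsetP FG) eG ev]; apply/joinsP; exists e.
Qed.

Lemma joins_connectS F G :
  F \subset G -> subrel (connect (joins F)) (connect (joins G)).
Proof. by move=> FG; apply: connect_sub => u v /(joinsS FG)/connect1. Qed.

Lemma edge_ends e : exists p : V * V, val e = [set p.1; p.2].
Proof.
by have /eqP/cards2P[u [v [_ ev]]] := edges_card2 (valP e); exists (u, v).
Qed.

Lemma ends_neq e u v : val e = [set u; v] -> u != v.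
Proof.
by move=> ev; have := edges_card2 (valP e); rewrite ev cards2; case: (u != v).
Qed.

Lemma joins_adj F : subrel (joins F) adj.
Proof. by move=> u v /joinsP[e _ ev]; rewrite /adj -ev (valP e). Qed.

Lemma forest_bridge F e u v : F \in forests -> e \in F ->
  val e = [set u; v] -> ~~ connect (joins (F :\ e)) u v.
Proof.
rewrite inE => /existsPn Fac eF ev; apply/negP => /connectP[p0 p0P].
case/shortenP: p0P => p pP pu _ vE; have uv := ends_neq ev.
have cyc : cycle (joins F) (u :: p).
  rewrite /= rcons_path (sub_path (joinsS (subD1set _ _)) pP) /= -vE.
  by apply/joinsP; exists e => //; rewrite setUC.
have sc : simple_cycle (u :: p).
  apply/and3P; split=> //; last exact: sub_cycle (@joins_adj F) _ cyc.
  case: p pP pu vE {cyc} => [|w [|? ?]] //= pP pu vE.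
    by rewrite vE eqxx in uv.
  move: pP; rewrite -vE andbT => /joinsP[e']; rewrite !inE => /andP[ne _] e'v.
  by case/eqP: ne; apply: val_inj; rewrite e'v ev.
case/negP: (Fac (cycle_edges (u :: p))); apply/andP; split.
  by apply/is_cycleP; exists (u :: p).
apply/subsetP => e'; rewrite inE => /existsP[x /andP[xc /eqP e'v]].
have /joinsP[e'' e''F e''v] := next_cycle cyc xc.
by have -> : e' = e'' by apply: val_inj; rewrite e'v e''v.
Qed.

Lemma bridge_forest F :
  (forall e u v, e \in F -> val e = [set u; v] ->
     ~~ connect (joins (F :\ e)) u v) -> F \in forests.
Proof.
move=> br; rewrite inE; apply/existsPn => C; apply/negP.
case/andP=> /is_cycleP[c /and3P[szc cu cc] ->] /subsetP cF.
have cyc : cycle (joins F) c.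
  apply: cycle_from_next => // x xc; have ax := next_cycle cc xc.
  apply/joinsP; exists (Sub [set x; next c x] ax : edge) => //.
  by apply: cF; rewrite inE; apply/existsP; exists x; rewrite xc SubK eqxx.
case: c szc cu cyc {cc cF} => [|u [|w p]] //= szp cu.
rewrite rcons_path => /and3P[uw wp].
have [p' [v pE]] : exists p' v, p = rcons p' v.
  by case/lastP: p szp {cu wp} => // p' v _; exists p', v.
have vL : last w p = v by rewrite pE last_rcons.
rewrite vL => /joinsP[e eF ev].
case/andP: cu => ucu wu; rewrite setUC in ev.
suff : connect (joins (F :\ e)) u v by apply/negP; apply: br eF ev.
have D1 x y : [set x; y] != [set u; v] -> joins F x y -> joins (F :\ e) x y.
  move=> xy /joinsP[e' e'F e'v]; apply/joinsP; exists e' => //.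
  by rewrite !inE e'F andbT; apply: contra xy => /eqP E; rewrite -e'v E ev.
have vp : v \in p by rewrite pE mem_rcons mem_head.
have ww : w != v by case/andP: wu => wn _; apply: contraNneq wn => ->.
have uw' : u != w by apply: contraNneq ucu => ->; rewrite mem_head.
apply: (@connect_trans _ _ w).
  apply/connect1/D1 => //; apply/eqP => /setP/(_ w).
  by rewrite !inE eqxx orbT (negPf ww) eq_sym (negPf uw').
apply/connectP; exists p => //.
suff H : {in w :: p &, subrel (joins F) (joins (F :\ e))}.
  by apply: (sub_in_path H _ wp); apply/allP.
move=> x y xp yp; apply: D1; apply/eqP => /setP/(_ u).
by rewrite !inE eqxx /=; case/orP=> /eqP uE; rewrite uE ?xp ?yp in ucu.
Qed.

Lemma forest_card (A B : {set edge}) : B \in forests ->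
  (forall e u v, e \in B -> val e = [set u; v] -> connect (joins A) u v) ->
  #|B| <= #|A|.
Proof.
move=> Bf; have [n] := ubnP #|B :\: A|; elim: n A => // n IH A.
rewrite ltnS => le_n conA.
have [/eqP|[e]] := set_0Vmem (B :\: A).
  by rewrite setD_eq0 => /subset_leq_card.
rewrite inE => /andP[eA eB].
have [[u v] /= ev] := edge_ends e.
have /connectP[p0 p0P] := conA _ _ _ eB ev.
case/shortenP: p0P => p pP pu _ vE.
have [p1 [y [p2 [pE /joinsP[f fA fv] fB]]]] : exists p1 y p2,
    [/\ p = p1 ++ y :: p2, joins A (last u p1) y
      & ~~ joins (B :\ e) (last u p1) y].
  have : ~~ path (joins (B :\ e)) u p.
    apply: contra (forest_bridge Bf eB ev) => pB.
    by apply/connectP; exists p.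
  elim: p u pP {pu vE ev p0} => //= y p IHp u /andP[uy yp].
  rewrite negb_and; case/orP => [nuy|/(IHp _ yp)].
    by exists [::], y, p.
  by move=> [p1 [z [p2 [-> jA jB]]]]; exists (y :: p1), z, p2.
set x := last u p1 in fv fB.
have fnB : f \notin B.
  apply: contra fB => fB; apply/joinsP; exists f => //.
  by rewrite !inE fB andbT; apply: contraNneq eA => <-.
pose A' := e |: (A :\ f).
have cA' : #|A'| = #|A|.
  by rewrite cardsU1 !inE (negPf eA) andbF /= (cardsD1 f A) fA.
have dE : #|B :\: A'| < n.
  apply: leq_trans le_n; apply: proper_card; apply/properP; split.
    apply/subsetP => g; rewrite !inE negb_or negb_and negbK.
    case/andP=> /andP[_ /orP[/eqP->|->] //] gB; by rewrite gB in fnB.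
  by exists e; rewrite !inE ?eA ?eB ?eqxx.
rewrite -cA'; apply: IH => // g a b gB gv.
have AA' : subrel (joins (A :\ f)) (joins A') by apply/joinsS/subsetUr.
have neqf a' b' : [set a'; b'] != [set x; y] -> joins A a' b' -> joins A' a' b'.
  move=> ne /joinsP[h hA hv]; apply/AA'/joinsP; exists h => //.
  by rewrite !inE hA andbT; apply: contra ne => /eqP E; rewrite -hv E fv.
have cxy : connect (joins A') x y.
  move: pP pu; rewrite pE cat_path -cat_cons cat_uniq /= -/x => /and3P[p1P _ p2P].
  case/and4P=> _; rewrite negb_or => /andP[yp1 /hasPn p1p2] yp2 _.
  have cux : connect (joins A') u x.
    apply/connectP; exists p1 => //.
    suff H : {in u :: p1 &, subrel (joins A) (joins A')}.
      by apply: (sub_in_path H _ p1P); apply/allP.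
    move=> a' b' a'p b'p; apply: neqf; apply/eqP => /setP/(_ y).
    rewrite !inE eqxx orbT; case/orP=> /eqP yE; first by rewrite yE a'p in yp1.
    by rewrite yE b'p in yp1.
  have cyv : connect (joins A') y v.
    apply/connectP; exists p2; last by rewrite vE pE last_cat.
    have xp2 : x \notin y :: p2.
      have xp1 : x \in u :: p1 by apply: mem_last.
      rewrite inE negb_or; apply/andP; split; last first.
        by apply/negP => /p1p2; rewrite xp1.
      by apply: contraNneq yp1 => <-.
    suff H : {in y :: p2 &, subrel (joins A) (joins A')}.
      by apply: (sub_in_path H _ p2P); apply/allP.
    move=> a' b' a'p b'p; apply: neqf; apply/eqP => /setP/(_ x).
    rewrite !inE eqxx /=; case/orP=> /eqP xE; first by rewrite xE a'p in xp2.
    by rewrite xE b'p in xp2.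
  have cuv : connect (joins A') u v.
    by apply/connect1/joinsP; exists e => //; rewrite !inE eqxx.
  apply: (@connect_trans _ _ u); first by rewrite joins_connect_sym.
  by apply: connect_trans cuv _; rewrite joins_connect_sym.
have := conA _ _ _ gB gv; apply: connect_sub => a' b' ab.
have [E|ne] := eqVneq [set a'; b'] [set x; y]; last exact/connect1/neqf.
have /joinsP[h _ /ends_neq ab'] := ab.
have : (a' \in [set x; y]) && (b' \in [set x; y]) by rewrite -E !inE !eqxx orbT.
rewrite !inE => /andP[/orP[]/eqP aE /orP[]/eqP bE]; move: ab';
  rewrite aE bE ?eqxx // => _.
by rewrite joins_connect_sym.
Qed.

Lemma forests_neq0 : forests != set0.
Proof.
apply/set0Pn; exists set0; apply: bridge_forest => e u v.
by rewrite inE.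
Qed.

Lemma forests_sub (A B : {set edge}) :
  A \subset B -> B \in forests -> A \in forests.
Proof.
rewrite !inE => AB; apply: contra => /existsP[C /andP[cC CA]].
by apply/existsP; exists C; rewrite cC (subset_trans CA).
Qed.

Lemma forests_exchange (A B : {set edge}) :
  A \in forests -> B \in forests -> #|A| < #|B| ->
  exists2 e, e \in B :\: A & e |: A \in forests.
Proof.
move=> Af Bf ltAB.
have /existsP[e /andP[eB /existsP[[u v] /andP[/eqP ev0 nuv]]]] :
    [exists e, (e \in B) && [exists p : V * V,
      (val e == [set p.1; p.2]) && ~~ connect (joins A) p.1 p.2]].
  apply: contraLR ltAB => /existsPn nB; rewrite -leqNgt; apply: forest_card => //.
  move=> e u v eB ev; apply: contraR (nB e) => nuv; rewrite eB.
  by apply/existsP; exists (u, v); rewrite ev eqxx.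
have ev : val e = [set u; v] := ev0; rewrite {ev0}/= in nuv.
have eA : e \notin A.
  by apply: contra nuv => eA; apply/connect1/joinsP; exists e.
exists e; first by rewrite inE eA.
apply: bridge_forest => g x y; rewrite !inE; case/orP=> [/eqP->|gA] gv.
  have -> : (e |: A) :\ e = A by apply/setU1K.
  have : (u \in [set x; y]) && (v \in [set x; y]) by rewrite -gv ev !inE !eqxx orbT.
  have uv := ends_neq ev; move: uv nuv.
  rewrite !inE => uv nuv /andP[/orP[]/eqP aE /orP[]/eqP bE]; move: uv nuv;
    rewrite aE bE ?eqxx //.
  by rewrite joins_connect_sym.
pose D := A :\ g.
have nxy : ~~ connect (joins D) x y by apply: forest_bridge gv.
have DA : D \subset A by apply: subD1set.
(* adding e only merges the classes of u and v *)
have key z : connect (joins ((e |: A) :\ g)) x z ->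
    [|| connect (joins D) x z, connect (joins D) x u && connect (joins D) v z
      | connect (joins D) x v && connect (joins D) u z].
  case/connectP=> p; elim/last_ind: p z => [|p w IHp] z /=.
    by move=> _ ->; rewrite connect0.
  rewrite rcons_path last_rcons => /andP[pP jw] ->.
  have := IHp _ pP erefl; set z' := last x p in jw *.
  have /joinsP[h] := jw; rewrite !inE => /andP[hg /orP[/eqP->|hA]] hv.
    have : (z' \in [set u; v]) && (w \in [set u; v]) by rewrite -ev hv !inE !eqxx orbT.
    have := ends_neq hv.
    rewrite !inE => zw /andP[/orP[]/eqP aE /orP[]/eqP bE]; move: zw;
      rewrite aE bE ?eqxx // => _; rewrite !connect0 ?andbT ?andbF.
      by case/or3P=> [->|/andP[-> _]|->]; rewrite ?orbT.
    by case/or3P=> [->|->|/andP[-> _]]; rewrite ?orbT.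
  have czw : connect (joins D) z' w.
    by apply/connect1/joinsP; exists h => //; rewrite !inE hg.
  case/or3P=> [c|/andP[-> c]|/andP[-> c]]; rewrite (connect_trans c czw) ?orbT //.
apply/negP => /key; rewrite (negPf nxy) /=.
have cxy : connect (joins A) x y by apply/connect1/joinsP; exists g.
case/orP=> /andP[/(joins_connectS DA) c1 /(joins_connectS DA) c2]; case/negP: nuv.
  rewrite joins_connect_sym (connect_trans c2) //.
  by rewrite joins_connect_sym in cxy; apply: connect_trans cxy c1.
rewrite joins_connect_sym in c1; rewrite joins_connect_sym.
by apply: connect_trans c1 (connect_trans cxy _); rewrite joins_connect_sym.
Qed.

Definition cycle_matroid : matroid edge :=
  Matroid forests_neq0 forests_sub forests_exchange.

Lemma set2_inj u v x y :
  [set u; v] = [set x; y] -> (u = x /\ v = y) \/ (u = y /\ v = x).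
Proof.
move=> E.
have : (u \in [set x; y]) && (v \in [set x; y]) by rewrite -E !inE !eqxx orbT.
have : (x \in [set u; v]) && (y \in [set u; v]) by rewrite E !inE !eqxx orbT.
rewrite !inE => /andP[xE yE] /andP[/orP[]/eqP uE /orP[]/eqP vE]; subst u v.
- by left; move: yE; rewrite orbb => /eqP.
- by left.
- by right.
- by right; move: xE; rewrite orbb => /eqP.
Qed.

Lemma next_neq_prev (c : seq V) x :
  2 < size c -> uniq c -> x \in c -> next c x != prev c x.
Proof.
move=> szc cu xc; apply/negP => /eqP nxt.
have nn : next c (next c x) = x by rewrite nxt next_prev.
have cyc : fcycle (next c) [:: x; next c x] by rewrite /= nn !eqxx.
have := order_le_cycle cyc (mem_head _ _).
by rewrite (order_cycle (cycle_next cu)) //= leqNgt szc.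
Qed.

Lemma cycle_edges_min (c c' : seq V) : simple_cycle c -> simple_cycle c' ->
  cycle_edges c' \subset cycle_edges c -> cycle_edges c' = cycle_edges c.
Proof.
move=> /and3P[szc cu cc] /and3P[szc' cu' cc'] /subsetP sub.
have step x y : x \in c' -> [set x; y] = [set x; next c' x] \/
    [set x; y] = [set prev c' x; x] -> y \in [:: next c x; prev c x].
  move=> xc' xyE.
  have [g gc' gv] : exists2 g : edge, g \in cycle_edges c' & val g = [set x; y].
    case: xyE => E.
      have ax := next_cycle cc' xc'.
      exists (Sub [set x; next c' x] ax : edge); rewrite ?SubK ?E //.
      by rewrite inE; apply/existsP; exists x; rewrite xc' SubK eqxx.
    have ax := prev_cycle cc' xc'.
    exists (Sub [set prev c' x; x] ax : edge); rewrite ?SubK ?E //.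
    rewrite inE; apply/existsP; exists (prev c' x).
    by rewrite mem_prev xc' SubK next_prev ?eqxx.
  have := sub _ gc'; rewrite inE => /existsP[z /andP[zc /eqP]].
  rewrite gv !inE => /set2_inj[[-> ->]|[-> ->]]; first by rewrite eqxx.
  by rewrite prev_next ?eqxx ?orbT.
have inc' x : x \in c' -> (next c' x == next c x) && (prev c' x == prev c x) ||
                         (next c' x == prev c x) && (prev c' x == next c x).
  move=> xc'; have := next_neq_prev szc' cu' xc'.
  have := step x (next c' x) xc' (or_introl erefl).
  have := step x (prev c' x) xc' (or_intror (setUC _ _)).
  rewrite !inE => /orP[]/eqP-> /orP[]/eqP->; rewrite ?eqxx ?orbT //.
have closed_c' x : x \in c' -> next c x \in c'.
  move=> xc'; have := inc' x xc'.
  by case/orP=> /andP[/eqP e1 /eqP e2]; rewrite -?e1 -?e2 ?mem_next ?mem_prev.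
have [x0 x0c'] : exists x0, x0 \in c' by case: c' szc' {cu' cc' sub step inc' closed_c'} => // x0 ? _; exists x0; rewrite mem_head.
have x0c : x0 \in c.
  have : next c' x0 \in c' by rewrite mem_next.
  have ax := next_cycle cc' x0c'.
  have : (Sub [set x0; next c' x0] ax : edge) \in cycle_edges c'.
    by rewrite inE; apply/existsP; exists x0; rewrite x0c' SubK eqxx.
  move/sub; rewrite inE => /existsP[z /andP[zc /eqP]]; rewrite SubK.
  by case/set2_inj=> -[-> _] // _; rewrite mem_next.
have sub_c : {subset c <= c'}.
  move=> y yc; have : fconnect (next c) x0 y.
    by rewrite (fconnect_cycle (cycle_next cu)).
  case/connectP=> p; elim: p x0 x0c' {x0c} => [|z p IHp] x xc' /=; first by move=> _ ->.
  by case/andP=> /eqP<- pP yE; apply: (IHp _ _ pP yE); apply: closed_c'.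
apply/eqP; rewrite eqEsubset; apply/andP; split; first exact/subsetP.
apply/subsetP => g; rewrite !inE => /existsP[x /andP[xc /eqP gv]].
have xc' := sub_c _ xc; apply/existsP.
case/orP: (inc' _ xc') => /andP[/eqP e1 /eqP e2].
  by exists x; rewrite xc' gv e1 eqxx.
by exists (prev c' x); rewrite mem_prev xc' gv next_prev // e2 setUC eqxx.
Qed.

Lemma circuit_cycle_matroid (C : {set edge}) :
  circuit cycle_matroid C = is_cycle C.
Proof.
have depP (A : {set edge}) : reflect (exists2 D, is_cycle D & D \subset A) (A \notin forests).
  rewrite inE negbK.
  by apply: (iffP existsP) => [[D /andP[]]|[D dD DA]]; exists D; rewrite ?dD.
apply/minsetP/idP => /= [[/depP[D cD DC] minC]|cC].
  suff <- : D = C by [].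
  by apply: minC => //; apply/depP; exists D.
split=> [|A /depP[D cD DA] AC]; first by apply/depP; exists C.
have DC : D = C.
  case/is_cycleP: cC AC => c sc ->; case/is_cycleP: cD DA => d sd -> dA Ac.
  exact: cycle_edges_min (subset_trans dA Ac).
by apply/eqP; rewrite eqEsubset AC -DC DA.
Qed.

End Graphic.

Definition symbol : Type := option bool. (* [None] is the blank *)

(* [lft] lists the cells to the left of the head, nearest first; all cells
   beyond the two lists are blank. *)
Record tape := Tape { lft : seq symbol; scanned : symbol; rgt : seq symbol }.

Variant move := MoveL | Stay | MoveR.

Definition write_move (a : symbol * move) (t : tape) : tape :=
  match a.2 with
  | MoveL => Tape (behead (lft t)) (head None (lft t)) (a.1 :: rgt t)
  | Stay => Tape (lft t) a.1 (rgt t)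
  | MoveR => Tape (a.1 :: lft t) (head None (rgt t)) (behead (rgt t))
  end.

Definition tape_of (w : seq bool) : tape :=
  Tape [::] (ohead w) [seq Some b | b <- behead w].

Fixpoint take_word (s : seq symbol) : seq bool :=
  if s is Some b :: s' then b :: take_word s' else [::].

(* The word on a tape starts under the head and stops before the first blank. *)
Definition word_of (t : tape) : seq bool := take_word (scanned t :: rgt t).

(* [Query q1 q0] submits the word of the query tape, in one step and leaving
   all tapes unchanged, and goes to [q1] or [q0] according to the answer. *)
Variant instruction (Q I : finType) :=
  | Halt
  | Query of Q & Q
  | Act of {ffun I -> symbol} -> Q * {ffun I -> symbol * move}.

Record machine := Machine {
  state : finType;
  tape_id : finType;
  start : state;
  input_tape : tape_id;
  query_tape : tape_id;
  output_tape : tape_id;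
  delta : state -> instruction state tape_id }.

Section Run.
Variables (M : machine) (O : pred (seq bool)).

Record config := Config {
  cur_state : state M;
  tapes : {ffun tape_id M -> tape} }.

Definition init (w : seq bool) : config :=
  Config (start M) [ffun i => tape_of (if i == input_tape M then w else [::])].

Definition halted (c : config) : bool :=
  if delta (cur_state c) is Halt then true else false.

Definition step (c : config) : config :=
  match delta (cur_state c) with
  | Halt => c
  | Query q1 q0 =>
      Config (if O (word_of (tapes c (query_tape M))) then q1 else q0) (tapes c)
  | Act f =>
      let: (q, a) := f [ffun i => scanned (tapes c i)] in
      Config q [ffun i => write_move (a i) (tapes c i)]
  end.

Definition halts_with (w : seq bool) (t : nat) (v : seq bool) : Prop :=
  let c := iter t step (init w) in
  halted c /\ word_of (tapes c (output_tape M)) = v.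

End Run.

Record problem := Problem {
  instance : Type;
  encode : instance -> seq bool;
  yes : instance -> Prop }.

Record oracle_problem := OracleProblem {
  oinstance : Type;
  oencode : oinstance -> seq bool;
  oracle : oinstance -> pred (seq bool);
  oyes : oinstance -> Prop }.

Definition poly_reducible (P : oracle_problem) (Q : problem) : Prop :=
  exists (M : machine) (p : {poly nat}), forall x : oinstance P,
  exists (t : nat) (y : instance Q),
    [/\ t <= p.[size (oencode x)]%R,
        halts_with M (oracle x) (oencode x) t (encode y)
      & oyes x <-> yes y].

Definition unary (n : nat) : seq bool := rcons (nseq n true) false.

Record matroid_pair (b : nat) := MatroidPair {
  size1 : nat;
  size2 : nat;
  matroid1 : matroid 'I_size1;
  matroid2 : matroid 'I_size2;
  rank1 : rank matroid1 <= b;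
  rank2 : rank matroid2 <= b }.

(* Sets of elements are queried as characteristic vectors. *)
Definition indep_oracle (n : nat) (M : matroid 'I_n) (v : seq bool) : bool :=
  (size v == n) && ([set i : 'I_n | nth false v i] \in indep M).

Definition pair_oracle (b : nat) (x : matroid_pair b) : pred (seq bool) :=
  fun q => match q with
           | [::] => false
           | false :: v => indep_oracle (matroid1 x) v
           | true :: v => indep_oracle (matroid2 x) v
           end.

(* Unary sizes make the input length linear in the number of elements: the
   ground sets count as listed explicitly, only independence is queried. *)
Definition MI (b : nat) : oracle_problem :=
  {| oinstance := matroid_pair b;
     oencode := fun x => unary (size1 x) ++ unary (size2 x);
     oracle := @pair_oracle b;
     oyes := fun x => matroid_iso (matroid1 x) (matroid2 x) |}.

Definition encode_graph (X : sgraph) : seq bool :=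
  unary (nv X) ++
  [seq @adj X u v | u <- enum 'I_(nv X), v <- enum 'I_(nv X)].

Definition GMI : problem :=
  {| instance := (sgraph * sgraph)%type;
     encode := fun X => encode_graph X.1 ++ encode_graph X.2;
     yes := fun X => matroid_iso (cycle_matroid X.1) (cycle_matroid X.2) |}.

(* Main.v *)
From mathcomp Require Import all_boot ssralg poly zify.
Require Import Defs.

Set Implicit Arguments.
Unset Strict Implicit.
Unset Printing Implicit Defensive.

(* A matroid of rank at most b is turned into a graph: the cone, with apex a hub,
   over the bipartite incidence graph between the elements x and certain blocks,
   namely the tuples of length b + 1 whose entries form an independent set, and
   b + 2 pendant blocks for each element. The triangles of the cone are exactly
   the hub-element-block triples with the element on the block, so a block edge
   lies in at most b + 1 triangles, while the spoke from the hub to x lies in at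
   least b + 2. Triangles being the circuits of size 3, an isomorphism of cycle
   matroids maps spokes to spokes, which defines a bijection of the elements. A set
   of at least two elements is independent iff some edge shares triangles with
   exactly its spokes, and x is not a loop iff its spoke lies in more than b + 2
   triangles; so this bijection is an isomorphism, without any appeal to Whitney's
   theorem on 2-isomorphism.

   Each bit of the adjacency matrix is a question about the coincidences between
   two tuples together with one oracle query. Keeping every coordinate as a row
   with one marked cell, a machine answers it in one sweep over the rows, and runs
   through all pairs of tuples by nested loops. *)

(** * Tuples and vertices *)

Fixpoint words (A : Type) (s : seq A) l : seq (seq A) :=
  if l is l.+1 then [seq a :: t | a <- s, t <- words s l] else [:: [::]].

Lemma map_words (A B : Type) (f : A -> B) s l :
  words (map f s) l = map (map f) (words s l).
Proof.
by elim: l => //= l ->; rewrite allpairs_mapl allpairs_mapr map_allpairs.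
Qed.

Lemma mem_words (A : eqType) (s : seq A) l t :
  (t \in words s l) = (size t == l) && all (mem s) t.
Proof.
elim: l t => [|l IH] [|a t] //=.
  by apply/negP => /allpairsP[[? ?] [_ _ /=]].
rewrite eqSS andbCA -IH; apply/allpairsP/andP => [[[b u] /= [? ? [-> ->]]] //|[? ?]].
by exists (a, t).
Qed.

Lemma words_uniq (A : eqType) (s : seq A) l : uniq s -> uniq (words s l).
Proof.
move=> us; elim: l => //= l IH; apply: allpairs_uniq => //.
by move=> [? ?] [? ?] _ _ /= [-> ->].
Qed.

Lemma flatten_allpairs (A B C D : Type) (f : A -> B -> C) (g : C -> seq D) s t :
  flatten [seq g x | x <- [seq f a b | a <- s, b <- t]] =
  flatten [seq flatten [seq g (f a b) | b <- t] | a <- s].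
Proof. by elim: s => //= a s <-; rewrite map_cat flatten_cat -map_comp. Qed.

Arguments words : simpl never.

(* [None] is the hub. [Some (c, t)] is a block for [c = 0], an element for
   [c = 1] and a pendant for [c > 1]. Elements and pendants only matter when [t]
   is constant, blocks only when the entries of [t] form an independent set; all
   other vertices end up isolated, which the cycle matroid does not see. *)
Definition vertices (A : Type) L (s : seq A) l : seq (option (nat * seq A)) :=
  None :: [seq Some (c, t) | c <- iota 0 L, t <- words s l].

Definition vertex_map (A B : Type) (f : A -> B) (u : option (nat * seq A)) :=
  omap (fun ct => (ct.1, map f ct.2)) u.

Lemma map_vertices (A B : Type) (f : A -> B) L s l :
  vertices L (map f s) l = map (vertex_map f) (vertices L s l).
Proof. by rewrite /vertices /= map_words map_allpairs allpairs_mapr. Qed.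

(** Kinds of vertices that may be joined, [None] standing for the hub: the hub with all others, and
    otherwise two kinds of which exactly one is that of elements. *)
Definition joinable (c d : option nat) : bool :=
  match c, d with
  | None, None => false
  | Some c, Some d => (c == 1) != (d == 1)
  | _, _ => true
  end.

Section Incidence.
Variable A : eqType.
Implicit Types u v : option (nat * seq A).

(** A nonconstant tuple of positive kind is incident with nothing, which leaves its vertex
    isolated. *)
Definition incident u (a : A) : bool :=
  match u with
  | None => true
  | Some (c, t) => if c == 0 then a \in t else all (pred1 a) t
  end.

(** Joinable vertices include at most one block, so a single query decides an adjacency: it asks for
    the entries of that block, or for the empty set. *)
Definition queried u (a : A) : bool :=
  if u is Some (c, t) then (c == 0) && (a \in t) else false.

End Incidence.

(** * Structured programs for oracle machines *)

Section Programs.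
Variable I : finType.

Inductive prog :=
  | Do of {ffun I -> symbol} -> {ffun I -> symbol * move}
  | Seq of prog & prog
  | While of ({ffun I -> symbol} -> bool) & prog
  | Ask of prog & prog.

Definition tapes_of := {ffun I -> tape}.
Implicit Types (T : tapes_of) (p q : prog).

Definition scan T : {ffun I -> symbol} := [ffun i => scanned (T i)].

Definition act (a : {ffun I -> symbol * move}) T : tapes_of :=
  [ffun i => write_move (a i) (T i)].

Definition idle (a : {ffun I -> symbol}) : {ffun I -> symbol * move} :=
  [ffun i => (a i, Stay)].

Lemma act_idle T : act (idle (scan T)) T = T.
Proof. by apply/ffunP => i; rewrite !ffunE; case: (T i). Qed.

(** Control points. The extra [None] of [While] and [Ask] is the point where the test or the query
    is made. *)
Fixpoint pstate p : finType :=
  match p with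
  | Do _ => unit : finType
  | Seq p q => (pstate p + pstate q)%type : finType
  | While _ p => option (pstate p) : finType
  | Ask p q => option (pstate p + pstate q) : finType
  end.

Fixpoint entry p : pstate p :=
  match p with
  | Do _ => tt
  | Seq p q => inl (entry p)
  | While _ p => None
  | Ask p q => None
  end.

(* The states of [p] are placed in [Q] by [inj]; control leaves [p] to [ex]. *)
Fixpoint code p (Q : finType) :
    (pstate p -> Q) -> Q -> pstate p -> instruction Q I :=
  match p with
  | Do f => fun inj ex _ => Act (fun a => (ex, f a))
  | Seq p q => fun inj ex s =>
      match s with
      | inl s => code (fun s => inj (inl s)) (inj (inr (entry q))) s
      | inr s => code (fun s => inj (inr s)) ex s
      end
  | While t p => fun inj ex s =>
      match s with
      | None => Act (fun a => (if t a then inj (Some (entry p)) else ex, idle a))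
      | Some s => code (fun s => inj (Some s)) (inj None) s
      end
  | Ask p q => fun inj ex s =>
      match s with
      | None => Query I (inj (Some (inl (entry p)))) (inj (Some (inr (entry q))))
      | Some (inl s) => code (fun s => inj (Some (inl s))) ex s
      | Some (inr s) => code (fun s => inj (Some (inr s))) ex s
      end
  end.

Variables (iI qI oI : I).

Definition machine_of p : machine :=
  @Machine (option (pstate p)) I (Some (entry p)) iI qI oI
    (fun s => if s is Some s then code (@Some _) None s else Halt _ _).

(** * Executions with counted steps, and total correctness with time bounds *)

Section Exec.
Variable O : pred (seq bool).

Inductive exec : prog -> tapes_of -> tapes_of -> nat -> Prop :=
  | ExecDo f T : exec (Do f) T (act (f (scan T)) T) 1
  | ExecSeq p q T1 T2 T3 s t :
      exec p T1 T2 s -> exec q T2 T3 t -> exec (Seq p q) T1 T3 (s + t)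
  | ExecWhileF b p T : ~~ b (scan T) -> exec (While b p) T T 1
  | ExecWhileT (b : {ffun I -> symbol} -> bool) p T1 T2 T3 s t : b (scan T1) ->
      exec p T1 T2 s -> exec (While b p) T2 T3 t ->
      exec (While b p) T1 T3 (1 + (s + t))
  | ExecAskT p q T1 T2 t : O (word_of (T1 qI)) ->
      exec p T1 T2 t -> exec (Ask p q) T1 T2 t.+1
  | ExecAskF p q T1 T2 t : ~~ O (word_of (T1 qI)) ->
      exec q T1 T2 t -> exec (Ask p q) T1 T2 t.+1.

(** The embedding [inj] and the exit [ex] are arbitrary, so that the induction on the execution
    applies to subprograms placed inside the whole program [p0]. *)
Lemma exec_code p0 p (inj : pstate p -> option (pstate p0)) ex T T' t :
  (forall s, delta (m := machine_of p0) (inj s) = code inj ex s) ->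
  exec p T T' t ->
  iter t (step O) (@Config (machine_of p0) (inj (entry p)) T) =
  @Config (machine_of p0) ex T'.
Proof.
move=> inj_code eT; elim: eT inj ex inj_code => {p T T' t}.
- move=> f T inj ex inj_code.
  by rewrite /= /step (inj_code tt).
- move=> p q T1 T2 T3 s t _ IHp _ IHq inj ex inj_code.
  rewrite addnC iterD (IHp (fun s => inj (inl s)) (inj (inr (entry q)))).
    exact: (IHq (fun s => inj (inr s))) => s'; exact: (inj_code (inr s')).
  by move=> s'; exact: (inj_code (inl s')).
- move=> b p T /negPf bT inj ex inj_code.
  rewrite /= /step (inj_code None) /= -[[ffun i => _]]/(scan T) bT.
  by rewrite -[[ffun i => write_move _ _]]/(act (idle (scan T)) T) act_idle.
- move=> b p T1 T2 T3 s t bT _ IHp _ IHw inj ex inj_code.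
  rewrite addnC iterD [iter 1 _ _]/= /step (inj_code None) /=.
  rewrite -[[ffun i => scanned _]]/(scan T1) bT.
  rewrite -[[ffun i => write_move _ _]]/(act (idle (scan T1)) T1) act_idle.
  rewrite addnC iterD -/(step O) (IHp (fun s => inj (Some s)) (inj None)).
    exact: (IHw inj).
  by move=> s'; exact: (inj_code (Some s')).
- move=> p q T1 T2 t OT _ IH inj ex inj_code.
  rewrite iterSr /step (inj_code None) /= OT.
  apply: (IH (fun s => inj (Some (inl s)))) => s'.
  exact: (inj_code (Some (inl s'))).
- move=> p q T1 T2 t /negPf OT _ IH inj ex inj_code.
  rewrite iterSr /step (inj_code None) /= OT.
  apply: (IH (fun s => inj (Some (inr s)))) => s'.
  exact: (inj_code (Some (inr s'))).
Qed.

Lemma exec_halts_with p w T t :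
  exec p [ffun i => tape_of (if i == iI then w else [::])] T t ->
  halts_with (machine_of p) O w t (word_of (T oI)).
Proof.
move=> eT; rewrite /halts_with.
have -> : iter t (step O) (init (machine_of p) w) =
  @Config (machine_of p) None T by exact: (@exec_code p p (@Some _) None).
by [].
Qed.

(** A step puts at most one more cell to the left of a head. The output head stands just after the
    last bit written, so this will bound the length of the output. *)
Lemma exec_size_lft p T T' t i : exec p T T' t ->
  size (lft (T' i)) <= size (lft (T i)) + t.
Proof.
elim=> {p T T' t}.
- move=> f T; rewrite ffunE /write_move addn1.
  by case: (f _ i) => b [] //=; rewrite size_behead -subn1 leq_subLR addnC; lia.
- by move=> p q T1 T2 T3 s t _ h1 _ h2; lia.
- by move=> b p T _; lia.
- by move=> b p T1 T2 T3 s t _ _ h1 _ h2; lia.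
- by move=> p q T1 T2 t _ _; lia.
- by move=> p q T1 T2 t _ _; lia.
Qed.

Variable N : nat.
Implicit Types (P Q R : tapes_of -> Prop) (B : {poly nat}).

(** The bound is a polynomial evaluated at [N], so that one polynomial can serve a program on all
    inputs. *)
Definition hoare P p Q B : Prop := forall T, P T ->
  exists T' t, [/\ exec p T T' t, t <= B.[N]%R & Q T'].

Lemma hoare_weaken P P' Q Q' p B :
  hoare P p Q B -> (forall T, P' T -> P T) -> (forall T, Q T -> Q' T) ->
  hoare P' p Q' B.
Proof. by move=> h PP QQ T /PP/h[T' [t [? ? /QQ]]]; exists T', t. Qed.

Lemma hoare_do P Q f :
  (forall T, P T -> Q (act (f (scan T)) T)) -> hoare P (Do f) Q 1%R.
Proof.
move=> PQ T PT; exists (act (f (scan T)) T), 1.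
by split; [exact: ExecDo|rewrite hornerE|exact: PQ].
Qed.

Lemma hoare_seq P Q R p q B C :
  hoare P p Q B -> hoare Q q R C -> hoare P (Seq p q) R (B + C)%R.
Proof.
move=> hp hq T /hp[T1 [s [e1 le_s /hq[T2 [t [e2 le_t RT]]]]]].
exists T2, (s + t); split=> //; first exact: ExecSeq e1 e2.
by rewrite hornerD; apply: leq_add.
Qed.

(** At most [n] rounds, each with a test and a body, and then one failing test. *)
Definition while_cost (n B : {poly nat}) : {poly nat} := (n * (1 + B) + 1)%R.

(** The invariant is indexed by the number of rounds still to come, so it also settles the outcome
    of the test and the termination. *)
Lemma hoare_while (P : nat -> tapes_of -> Prop) b p n B r :
  (forall T, P 0 T -> ~~ b (scan T)) ->
  (forall i T, P i.+1 T -> b (scan T)) ->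
  (forall i, i < r -> hoare (P i.+1) p (P i) B) -> r <= n.[N]%R ->
  hoare (P r) (While b p) (P 0) (while_cost n B).
Proof.
move=> P0 PS hp rN T PT.
suff [T' [t [e le_t PT']]] :
    exists T' t, [/\ exec (While b p) T T' t, t <= r * (1 + B.[N]%R) + 1 & P 0 T'].
  exists T', t; split=> //; apply: leq_trans le_t _.
  rewrite /while_cost !(hornerD, hornerM, hornerX, hornerE) leq_add2r.
  exact: leq_mul.
elim: r hp {rN} T PT => [|r IH] hp T PT.
  by exists T, 1; split=> //; apply: ExecWhileF; apply: P0.
have [T1 [s [e1 le_s /IH]]] := hp r (leqnn _) T PT.
case=> [i lt_ir|T2 [t [e2 le_t PT2]]]; first exact: hp (leqW _).
exists T2, (1 + (s + t)); split=> //; first exact: ExecWhileT (PS _ _ PT) e1 e2.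
by rewrite mulSn -!addnA !leq_add.
Qed.

Lemma hoare_ask P Q p q B :
  hoare (fun T => P T /\ O (word_of (T qI))) p Q B ->
  hoare (fun T => P T /\ ~~ O (word_of (T qI))) q Q B ->
  hoare P (Ask p q) Q (1 + B)%R.
Proof.
move=> hp hq T PT; have [OT|OT] := boolP (O (word_of (T qI))).
  have [T' [t [e le_t QT]]] := hp T (conj PT OT); exists T', t.+1.
  by split=> //; [exact: ExecAskT|rewrite hornerD hornerE].
have [T' [t [e le_t QT]]] := hq T (conj PT OT); exists T', t.+1.
by split=> //; [exact: ExecAskF|rewrite hornerD hornerE].
Qed.

End Exec.
End Programs.

(** * Sweeps over the rows *)

Section Tapes.
Variable J : finType.

(* [Cnt s j] holds row [j] for matroid [s] ([false] is the first): one bit for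
   each element, of which at most one is set. *)
Definition tid : finType := option (option (option (option (bool * J)))).
Definition In : tid := None.
Definition Out : tid := Some None.
Definition Qry : tid := Some (Some None).
Definition Flg : tid := Some (Some (Some None)).
Definition Cnt (s : bool) (j : J) : tid := Some (Some (Some (Some (s, j)))).

Definition column := {ffun J -> bool}.
Definition row (j : J) (cs : seq column) : seq symbol := [seq Some (c j) | c : column <- cs].

(* [zipper l r]: the head reads the first cell of [r], [l] lies to its left. *)
Definition zipper (l r : seq symbol) : tape := Tape l (head None r) (behead r).

(** The rest position of a row. The explicit blanks at both ends stop the two passes of a sweep. *)
Definition home j cs := zipper [:: None] (row j cs ++ [:: None]).

Definition upd (A : Type) (f : bool -> A) s a : bool -> A :=
  fun s' => if s' == s then a else f s'.

Definition update_tapes (g : {ffun tid -> symbol} -> tid -> option (symbol * move))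
    (a : {ffun tid -> symbol}) : {ffun tid -> symbol * move} :=
  [ffun i => odflt (a i, Stay) (g a i)].

Lemma act_update g T i : act (update_tapes g (scan T)) T i =
  if g (scan T) i is Some w then write_move w (T i) else T i.
Proof. by rewrite !ffunE; case: (g _ i) => //=; case: (T i). Qed.

(** What holds between sweeps. To the right of its head the query tape may still carry an older
    query. *)
Definition inv (cols : bool -> seq column) out (T : tapes_of tid) : Prop :=
  [/\ forall s j, T (Cnt s j) = home j (cols s),
      T Out = Tape (rev [seq Some b | b <- out]) None [::]
    & lft (T Qry) = [::]].

Fixpoint mealy (g : bool -> column -> bool * column * bool) f cs :
    bool * seq column * seq bool :=
  if cs is c :: cs then
    let: (f1, c1, q1) := g f c in
    let: (f2, cs2, q2) := mealy g f1 cs in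
    (f2, c1 :: cs2, q1 :: q2)
  else (f, [::], [::]).

Lemma mealy_sizes g f cs f' cs' qs : mealy g f cs = (f', cs', qs) ->
  size cs' = size cs /\ size qs = size cs.
Proof.
elim: cs f f' cs' qs => [|c cs IH] f f' cs' qs /=; first by case=> _ <- <-.
case: (g f c) => [[f1 c1] q1]; case E: (mealy g f1 cs) => [[f2 cs2] q2].
by case=> _ <- <- /=; have [-> ->] := IH _ _ _ _ E.
Qed.

Definition column_at (a : {ffun tid -> symbol}) s : column :=
  [ffun j => a (Cnt s j) == Some true].

Variable j0 : J.
Variables (O : pred (seq bool)) (N : nat).
Notation hoare := (hoare Qry O N).

(** The rows of a side have equal length and their heads move together, so a single row tells when
    to stop. *)
Definition on_cells s (a : {ffun tid -> symbol}) := a (Cnt s j0) != None.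

(* The columns of side [s] run through the Mealy machine [g], whose state is the
   flag and whose output is the query word. The blank written when the heads turn
   back cuts off what remains of longer queries. *)
Definition sweep s f0 (g : bool -> column -> bool * column * bool) : prog tid :=
  Seq (Do (update_tapes (fun a i =>
    match i with
    | Some (Some None) => Some (Some s, MoveR)
    | Some (Some (Some None)) => Some (Some f0, Stay)
    | _ => None
    end)))
  (Seq (While (on_cells s) (Do (update_tapes (fun a i =>
    let r := g (a Flg == Some true) (column_at a s) in
    match i with
    | Some (Some None) => Some (Some r.2, MoveR)
    | Some (Some (Some None)) => Some (Some r.1.1, Stay)
    | Some (Some (Some (Some (s', j)))) =>
        if s' == s then Some (Some (r.1.2 j), MoveR) else None
    | _ => None
    end))))
  (Seq (Do (update_tapes (fun a i =>
    match i with
    | Some (Some None) => Some (None, MoveL)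
    | Some (Some (Some (Some (s', j)))) =>
        if s' == s then Some (a i, MoveL) else None
    | _ => None
    end)))
  (Seq (While (on_cells s) (Do (update_tapes (fun a i =>
    match i with
    | Some (Some None) => Some (a i, MoveL)
    | Some (Some (Some (Some (s', j)))) =>
        if s' == s then Some (a i, MoveL) else None
    | _ => None
    end))))
  (Do (update_tapes (fun a i =>
    match i with
    | Some (Some (Some (Some (s', j)))) =>
        if s' == s then Some (a i, MoveR) else None
    | _ => None
    end)))))).

Definition sweep_cost : {poly nat} :=
  (1 + (while_cost 'X 1 + (1 + (while_cost 'X 1 + 1))))%R.

Lemma take_word_cat w (r : seq symbol) :
  take_word ([seq Some b | b <- w] ++ None :: r) = w.
Proof. by elim: w => //= b w ->. Qed.

Lemma row_rev j cs : row j (rev cs) = rev (row j cs).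
Proof. exact: map_rev. Qed.

Lemma hoare_sweep s f0 g cols out f cs qs :
  size (cols s) <= N -> mealy g f0 (cols s) = (f, cs, qs) ->
  hoare (inv cols out) (sweep s f0 g)
    (fun T => [/\ inv (upd cols s cs) out T, scanned (T Flg) = Some f
                & word_of (T Qry) = s :: qs])
    sweep_cost.
Proof.
move=> sz_cols mE; have [sz_cs sz_qs] := mealy_sizes mE.
pose other (T : tapes_of tid) :=
  (forall s' j, s' != s -> T (Cnt s' j) = home j (cols s')) /\
  T Out = Tape (rev [seq Some b | b <- out]) None [::].
(* Forward pass with [n] columns to go: [d] and [qd] are the columns and query bits already written,
   after the side bit [s]. *)
pose P1 n T := exists d t f1 t' qd qt, [/\
  [/\ other T, size t = n, mealy g f1 t = (f, t', qt), d ++ t' = cs & qd ++ qt = qs],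
  scanned (T Flg) = Some f1,
  forall j, T (Cnt s j) = zipper (rev (row j d) ++ [:: None]) (row j t ++ [:: None])
  & lft (T Qry) = rev [seq Some b | b <- s :: qd]].
(* Backward pass with [n] columns to go back over; [x] is what an older query left beyond the
   blank. *)
pose P2 n T := exists l r ql qr x, [/\
  [/\ other T, size l = n, size ql = n, rev l ++ r = cs & rev ql ++ qr = qs],
  scanned (T Flg) = Some f,
  forall j, T (Cnt s j) = Tape (behead (row j l ++ [:: None]))
    (head None (row j l ++ [:: None])) (row j r ++ [:: None])
  & T Qry = Tape (behead ([seq Some b | b <- ql] ++ [:: Some s]))
      (head None ([seq Some b | b <- ql] ++ [:: Some s]))
      ([seq Some b | b <- qr] ++ None :: x)].
apply: (@hoare_seq _ _ _ _ _ (P1 (size (cols s)))).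
  apply: hoare_do => T [cE oE qE].
  exists [::], (cols s), f0, cs, [::], qs; split=> //.
  - split=> //; split=> [s' j _|]; rewrite act_update //=; exact: cE.
  - by rewrite act_update.
  - by move=> j; rewrite act_update /= cE.
  - by rewrite act_update /= qE.
apply: hoare_seq.
  apply: hoare_while => //; last by rewrite hornerX.
  - move=> T [d [t [f1 [t' [qd [qt [[_ /size0nil-> _ _ _] _ cE _]]]]]]].
    by rewrite /on_cells ffunE cE.
  - move=> i T [d [[|c t] [f1 [t' [qd [qt [[_ //= _ _ _ _] _ cE _]]]]]]].
    by rewrite /on_cells ffunE cE.
  move=> i _; apply: hoare_do => T.
  move=> [d [[|c t] [f1 [t' [qd [qt [[oT //= szt m1 dE qdE] fE cE qE]]]]]]].
  have colE : column_at (scan T) s = c.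
    apply/ffunP => j; rewrite !ffunE cE /=; by case: (c j).
  have flE : (scan T Flg == Some true) = f1 by rewrite ffunE fE; case: (f1).
  move: m1; case gE: (g f1 c) => [[f2 c2] q2]; case mE2: (mealy g f2 t) => [[f3 t3] q3].
  case=> f3E t'E qtE; subst f3 t' qt.
  exists (rcons d c2), t, f2, t3, (rcons qd q2), q3; split.
  - split=> //; rewrite ?cat_rcons //; last by case: szt.
    case: oT => h1 h2; split=> [s' j ns|]; rewrite act_update //=.
    by rewrite (negPf ns) h1.
  - by rewrite act_update /= flE colE gE.
  - move=> j; rewrite act_update /= flE colE gE /= eqxx cE /=.
    by rewrite /row map_rcons rev_rcons.
  - by rewrite act_update /= flE colE gE /= qE map_rcons -rcons_cons rev_rcons.
apply: (@hoare_seq _ _ _ _ _ (P2 (size (cols s)))).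
  apply: hoare_do => T [d [t [f1 [t' [qd [qt [[oT /size0nil tE m1 dE qdE] fE cE qE]]]]]]].
  move: m1; rewrite tE /= => -[f1E t'E qtE]; subst f1 t' qt t.
  rewrite !cats0 in dE qdE; subst d qd.
  exists (rev cs), [::], (rev qs), [::], (rgt (T Qry)).
  rewrite ?size_rev ?sz_cs ?sz_qs ?revK ?cats0; split=> //.
  - split=> //; case: oT => h1 h2; split=> [s' j ns|]; rewrite act_update //=.
    by rewrite (negPf ns) h1.
  - by rewrite act_update.
  - by move=> j; rewrite act_update /= eqxx cE ffunE cE /= row_rev.
  - by rewrite act_update /= /write_move /= qE /= rev_cons map_rev cats1.
apply: (@hoare_seq _ _ _ _ _ (P2 0)).
  apply: hoare_while => //; last by rewrite hornerX.
  - move=> T [l [r [ql [qr [x [[_ /size0nil-> _ _ _] _ cE _]]]]]].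
    by rewrite /on_cells ffunE cE.
  - move=> i T [[|c l] [r [ql [qr [x [[_ //= _ _ _ _] _ cE _]]]]]].
    by rewrite /on_cells ffunE cE.
  move=> i _; apply: hoare_do => T.
  move=> [[|c l] [r [[|q ql] [qr [x [[oT //= szl szq lE qlE] fE cE qE]]]]]].
  exists l, (c :: r), ql, (q :: qr), x; split=> //.
  - rewrite -cat_rcons -rev_cons -cat_rcons -rev_cons.
    split=> //; [|by case: szl|by case: szq].
    case: oT => h1 h2; split=> [s' j ns|]; rewrite act_update //=.
    by rewrite (negPf ns) h1.
  - by rewrite act_update.
  - by move=> j; rewrite act_update /= eqxx ffunE cE.
  - by rewrite act_update /= ffunE qE.
(* The query word has the extra bit [s] in front: its head is already on its first cell when the row
   heads reach the left blank, so only the latter move back by one. *)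
apply: hoare_do => T [l [r [ql [qr [x [[oT /size0nil lE /size0nil qlE rE qrE] fE cE qE]]]]]].
subst l ql; rewrite /= in rE qrE cE qE; subst r qr.
split; first split.
- move=> s' j; rewrite act_update /= /upd; case: eqP => [->|/eqP ns].
    by rewrite /write_move cE /= ffunE cE.
  by case: oT => ->.
- by rewrite act_update; case: oT.
- by rewrite act_update qE.
- by rewrite act_update.
- by rewrite act_update /= qE /word_of /= take_word_cat.
Qed.

End Tapes.

(** * Loops over tuples *)

Section Loops.
Variables (J : finType) (j0 : J) (O : pred (seq bool)) (N : nat).
Variable n : bool -> nat.
Hypothesis n_le : forall s, n s <= N.
Notation hoare := (hoare (Qry J) O N).
Notation marks := {ffun bool * J -> nat}.
Implicit Types (m : marks) (s : bool) (j : J) (out : seq bool).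

(* A value [m (s, j)] that is at least [n s] means that row [j] has no mark. *)
Definition columns m s : seq (column J) :=
  [seq [ffun j => m (s, j) == i] | i <- iota 0 (n s)].

Definition st m out := inv (columns m) out.

Definition setm m s j v : marks :=
  [ffun x => if x == (s, j) then v else m x].

Lemma inv_ext (cols cols' : bool -> seq (column J)) out T :
  (forall s, cols s = cols' s) -> inv cols out T -> inv cols' out T.
Proof. by move=> E [cE oE qE]; split=> // s j; rewrite cE E. Qed.

Lemma setm_id m s j : setm m s j (m (s, j)) = m.
Proof. by apply/ffunP => x; rewrite ffunE; case: eqP => // ->. Qed.

(* Shifting row [j] through the flag moves its mark by one cell, sets a mark when
   the flag starts as true, and leaves a mark that drops off the end in the flag. *)
Definition inc s j f0 : prog (tid J) :=
  sweep j0 s f0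
    (fun f c => (c j, [ffun j' => if j' == j then f else c j'], false)).

(** One statement covers the three uses in a loop: entering at [w = 0] from an unmarked row,
    advancing, and leaving at [w = n s], which is not a cell, so that the row is unmarked again. *)
Lemma hoare_inc m s j w out : w <= n s ->
  hoare (st (setm m s j (if w is v.+1 then v else n s)) out) (inc s j (w == 0))
    (fun T => st (setm m s j w) out T /\ scanned (T (Flg J)) = Some (w == n s))
    sweep_cost.
Proof.
move=> wn; pose g (f : bool) (c : column J) :=
  (c j, [ffun j' => if j' == j then f else c j'] : column J, false).
pose C (P : pred nat) i : column J :=
  [ffun j' => if j' == j then P i else m (s, j') == i].
(* When the heads are on cell [a], the flag tells whether the new mark belongs there. *)
have mE a l : mealy g (w == a) [seq C (fun i => w == i.+1) i | i <- iota a l] =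
    (w == a + l, [seq C (fun i => w == i) i | i <- iota a l], nseq l false).
  elim: l a => [|l IH] a /=; first by rewrite addn0.
  rewrite ffunE eqxx IH addnS; congr (_, _ :: _, _).
  by apply/ffunP => j'; rewrite !ffunE; case: eqP.
pose old := if w is v.+1 then v else n s.
have oldE : columns (setm m s j old) s = [seq C (fun i => w == i.+1) i | i <- iota 0 (n s)].
  apply/eq_in_map => i; rewrite mem_iota => /= i_lt; apply/ffunP => j'.
  rewrite !ffunE xpair_eqE eqxx /=; case: (j' == j) => //.
  by rewrite /old; case: (w) => [|v]; rewrite ?eqSS //; lia.
apply: hoare_weaken (@hoare_sweep _ j0 O N s (w == 0) g
  (columns (setm m s j old)) out _ _ _ _ _) _ _.
- by rewrite size_map size_iota.
- by rewrite oldE; exact: mE.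
- by [].
move=> T [iT -> _]; split=> //; apply: inv_ext iT => s'.
rewrite /upd; case: eqP => [->|/eqP ns].
  apply/eq_map => i; apply/ffunP => j'.
  by rewrite !ffunE xpair_eqE eqxx /=; case: (j' == j).
apply/eq_map => i; apply/ffunP => j'.
by rewrite !ffunE xpair_eqE (negPf ns).
Qed.

Definition for_ s j (body : prog (tid J)) : prog (tid J) :=
  Seq (inc s j true)
    (While (fun a => a (Flg J) == Some false) (Seq body (inc s j false))).

Definition for_cost (B : {poly nat}) : {poly nat} :=
  (sweep_cost + while_cost 'X (B + sweep_cost))%R.

Lemma hoare_for m s j body B (w : nat -> seq bool) out : m (s, j) = n s ->
  (forall v out, v < n s ->
     hoare (st (setm m s j v) out) body (st (setm m s j v) (out ++ w v)) B) ->
  hoare (st m out) (for_ s j body)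
    (st m (out ++ flatten [seq w v | v <- iota 0 (n s)])) (for_cost B).
Proof.
move=> mj hb.
(* With [r] rounds to go the mark is on cell [n s - r]; at [r = 0] it has dropped off, which
   restores [m]. *)
pose P r T := st (setm m s j (n s - r))
    (out ++ flatten [seq w v | v <- iota 0 (n s - r)]) T /\
  scanned (T (Flg J)) = Some (r == 0).
apply: (@hoare_seq _ _ _ _ _ (P (n s))).
  apply: hoare_weaken (@hoare_inc m s j 0 out (leq0n _)) _ _.
    by move=> T; rewrite -mj setm_id.
  by move=> T [iT fT]; rewrite /P subnn cats0 fT eq_sym.
apply: (@hoare_weaken _ _ _ _ (P (n s)) _ (P 0)) => //; last first.
  by move=> T [iT _]; move: iT; rewrite subn0 -mj setm_id.
apply: hoare_while; last by rewrite hornerX.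
- by move=> T [_ fT]; rewrite ffunE fT.
- by move=> i T [_ fT]; rewrite ffunE fT.
move=> i i_lt; set v := n s - i.+1.
have vE : n s - i = v.+1 by rewrite /v; lia.
set out' := out ++ flatten [seq w i | i <- iota 0 v].
apply: (@hoare_seq _ _ _ _ _ (st (setm m s j v) (out' ++ w v))).
  apply: hoare_weaken (hb v out' _) _ _ => [|T []|] //.
  by rewrite /v; lia.
apply: hoare_weaken (@hoare_inc m s j v.+1 (out' ++ w v) _) _ _.
- by rewrite -vE leq_subr.
- by [].
move=> T [iT fT]; split.
  by move: iT; rewrite vE -addn1 iotaD map_cat flatten_cat /= cats0 -catA.
by rewrite fT; congr Some; apply/eqP/eqP; lia.
Qed.

Fixpoint nest s js (body : prog (tid J)) : prog (tid J) :=
  if js is j :: js then for_ s j (nest s js body) else body.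

Fixpoint set_word m s js (t : seq nat) : marks :=
  if (js, t) is (j :: js, v :: t) then set_word (setm m s j v) s js t else m.

Lemma set_word_notin m s js t s' j :
  (s' != s) || (j \notin js) -> set_word m s js t (s', j) = m (s', j).
Proof.
elim: js m t => [|j' js IH] m [|v t] //=; rewrite inE negb_or => H.
rewrite IH; last by case/orP: H => [->//|/andP[_ ->]]; rewrite orbT.
rewrite ffunE xpair_eqE; case: eqP H => //= _; case: eqP => //=.
Qed.

Lemma map_set_word m s js t : uniq js -> size t = size js ->
  [seq set_word m s js t (s, j) | j <- js] = t.
Proof.
elim: js m t => [|j js IH] m [|v t] //= /andP[jn ujs] [szt].
rewrite IH // set_word_notin ?jn ?orbT //.
by rewrite ffunE eqxx.
Qed.

(** The outermost loop runs through the first entry of the tuple, which is the slowest to vary in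
    [words]. On exit the rows are unmarked again, so nests can follow or contain one another. *)
Lemma hoare_nest m s js body B (w : seq nat -> seq bool) out :
  uniq js -> (forall j, j \in js -> m (s, j) = n s) ->
  (forall t out, t \in words (iota 0 (n s)) (size js) ->
     hoare (st (set_word m s js t) out) body
       (st (set_word m s js t) (out ++ w t)) B) ->
  hoare (st m out) (nest s js body)
    (st m (out ++ flatten [seq w t | t <- words (iota 0 (n s)) (size js)]))
    (iter (size js) for_cost B).
Proof.
elim: js m w out => [|j js IH] m w out /=.
  by move=> _ _ /(_ [::] out (mem_head _ _)); rewrite cats0.
case/andP=> jn ujs mE hb; rewrite flatten_allpairs.
apply: (@hoare_for _ _ _ _ _ (fun v =>
  flatten [seq w (v :: t) | t <- words (iota 0 (n s)) (size js)])).
  by rewrite mE ?mem_head.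
move=> v out' v_lt; apply: IH => // [j' j'js|t out'' tw].
  rewrite ffunE xpair_eqE eqxx /=; case: eqP => [j'E|_].
    by rewrite -j'E j'js in jn.
  by rewrite mE // inE j'js orbT.
apply: (hb (v :: t)); apply/allpairsP; exists (v, t); split=> //=.
by rewrite mem_iota.
Qed.

Definition emit (h : {ffun tid J -> symbol} -> bool) : prog (tid J) :=
  Do (update_tapes (fun a i =>
    if i is Some None then Some (Some (h a), MoveR) else None)).

Lemma hoare_emit m out h b :
  hoare (fun T => st m out T /\ h (scan T) = b) (emit h) (st m (out ++ [:: b])) 1.
Proof.
apply: hoare_do => T [[cE oE qE] hT]; split.
- by move=> s j; rewrite act_update cE.
- by rewrite act_update /write_move oE /= hT map_cat rev_cat.
- by rewrite act_update.
Qed.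

Lemma hoare_emit_bit m out b :
  hoare (st m out) (emit (fun=> b)) (st m (out ++ [:: b])) 1.
Proof. by apply: hoare_weaken (@hoare_emit m out (fun=> b) b) _ _. Qed.

(** A single sweep both accumulates [has phi] in the flag and writes the query; a positive answer
    emits the flag, a negative one [false]. *)
Definition test s (phi qb : column J -> bool) : prog (tid J) :=
  Seq (sweep j0 s false (fun f c => (f || phi c, c, qb c)))
    (Ask (emit (fun a => a (Flg J) == Some true)) (emit (fun=> false))).

Definition test_cost : {poly nat} := (sweep_cost + (1 + 1))%R.

Lemma hoare_test m s (phi qb : column J -> bool) out :
  hoare (st m out) (test s phi qb)
    (st m (out ++ [:: has phi (columns m s) &&
                      O (s :: [seq qb c | c <- columns m s])])) test_cost.
Proof.
have mE f cs : mealy (fun f c => (f || phi c, c, qb c)) f cs =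
    (f || has phi cs, cs, [seq qb c | c <- cs]).
  by elim: cs f => [|c cs IH] f /=; rewrite ?orbF // IH orbA.
apply: (@hoare_seq _ _ _ _ _ (fun T => [/\ st m out T,
    scanned (T (Flg J)) = Some (has phi (columns m s))
  & word_of (T (Qry J)) = s :: [seq qb c | c <- columns m s]])).
  apply: hoare_weaken
    (@hoare_sweep _ j0 O N s false _ (columns m) out _ _ _ _ (mE _ _)) _ _ => //.
    by rewrite size_map size_iota.
  move=> T [iT fT qT]; split=> //; apply: inv_ext iT => s'.
  by rewrite /upd; case: eqP => // ->.
set b := _ && _; apply: hoare_ask.
  apply: hoare_weaken (@hoare_emit m out _ b) _ _ => //.
  move=> T [[iT fT qT] OT]; split=> //=; rewrite /b.
  by rewrite ffunE fT -qT OT andbT; case: (has _ _).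
apply: hoare_weaken (@hoare_emit m out _ b) _ _ => //.
by move=> T [[iT fT qT] /negPf OT]; split=> //; rewrite /b -qT OT andbF.
Qed.

Definition seqs (ps : seq (prog (tid J))) : prog (tid J) :=
  foldr (@Seq _) (Do (@idle _)) ps.

Definition seqs_cost l (B : {poly nat}) : {poly nat} := iter l (+%R B) 1%R.

Lemma hoare_seqs (A : eqType) (as_ : seq A) (p : A -> prog (tid J)) m B
    (w : A -> seq bool) out :
  (forall a out, a \in as_ -> hoare (st m out) (p a) (st m (out ++ w a)) B) ->
  hoare (st m out) (seqs (map p as_)) (st m (out ++ flatten (map w as_)))
    (seqs_cost (size as_) B).
Proof.
elim: as_ out => [|a as_ IH] out hp /=.
  by rewrite cats0; apply: hoare_do => T; rewrite act_idle.
rewrite catA; apply: hoare_seq; first by apply: hp; rewrite mem_head.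
by apply: IH => a' out' a'as; apply: hp; rewrite inE a'as orbT.
Qed.

(** The kind of a vertex lives in the finite control, with one copy of the body per kind; only the
    tuple is kept on tapes. *)
Definition for_vertices L s js (p : option nat -> prog (tid J)) : prog (tid J) :=
  Seq (p None) (seqs [seq nest s js (p (Some c)) | c <- iota 0 L]).

Definition for_vertices_cost L l (B : {poly nat}) : {poly nat} :=
  (B + seqs_cost L (iter l for_cost B))%R.

Definition set_vertex m s js (v : option (nat * seq nat)) : marks :=
  if v is Some (_, t) then set_word m s js t else m.

Lemma hoare_for_vertices L m s js p B (w : option (nat * seq nat) -> seq bool) out :
  uniq js -> (forall j, j \in js -> m (s, j) = n s) ->
  (forall v out, v \in vertices L (iota 0 (n s)) (size js) ->
     hoare (st (set_vertex m s js v) out) (p (omap fst v))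
       (st (set_vertex m s js v) (out ++ w v)) B) ->
  hoare (st m out) (for_vertices L s js p)
    (st m (out ++ flatten [seq w v | v <- vertices L (iota 0 (n s)) (size js)]))
    (for_vertices_cost L (size js) B).
Proof.
move=> ujs mE hp /=; rewrite catA flatten_allpairs.
apply: hoare_seq; first exact: (hp None _ (mem_head _ _)).
rewrite /= -[X in seqs_cost X _](size_iota 0 L).
apply: (@hoare_seqs _ _ (fun c => nest s js (p (Some c))) _ _
  (fun c => flatten [seq w (Some (c, t)) | t <- words (iota 0 (n s)) (size js)])).
move=> c out' cL.
apply: hoare_nest => // t out'' tw; apply: (hp (Some (c, t))).
by rewrite inE; apply/allpairsP; exists (c, t).
Qed.

End Loops.

(** * The machine *)

Section Ends.
Variables (J : finType) (j0 : J) (O : pred (seq bool)) (N : nat).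
Variable n : bool -> nat.
Hypothesis n_le : forall s, n s <= N.
Notation hoare := (hoare (Qry J) O N).

Definition setup s : prog (tid J) :=
  Seq (While (fun a => a (In J) == Some true) (Do (update_tapes (fun a i =>
    match i with
    | None => Some (a i, MoveR)
    | Some (Some (Some (Some (s', j)))) =>
        if s' == s then Some (Some false, MoveR) else None
    | _ => None
    end))))
  (Seq (Do (update_tapes (fun a i =>
    match i with
    | None => Some (a i, MoveR)
    | Some (Some (Some (Some (s', j)))) =>
        if s' == s then Some (a i, MoveL) else None
    | _ => None
    end)))
  (Seq (While (on_cells j0 s) (Do (update_tapes (fun a i =>
    match i with
    | Some (Some (Some (Some (s', j)))) =>
        if s' == s then Some (a i, MoveL) else None
    | _ => None
    end))))
  (Do (update_tapes (fun a i =>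
    match i with
    | Some (Some (Some (Some (s', j)))) =>
        if s' == s then Some (a i, MoveR) else None
    | _ => None
    end))))).

Definition setup_cost : {poly nat} :=
  (while_cost 'X 1 + (1 + (while_cost 'X 1 + 1)))%R.

Definition untouched s (i : tid J) : bool :=
  match i with
  | None => false
  | Some (Some (Some (Some (s', _)))) => s' != s
  | _ => true
  end.

(** Before both sides are laid out [inv] cannot be used, so [F] records the contents of the tapes
    that stay as they are. *)
Lemma hoare_setup s (F : tid J -> tape) w :
  hoare (fun T => [/\ exists l, T (In J) = zipper l [seq Some b | b <- unary (n s) ++ w],
                      forall j, T (Cnt s j) = Tape [::] None [::]
                    & forall i, untouched s i -> T i = F i])
    (setup s)
    (fun T => [/\ exists l, T (In J) = zipper l [seq Some b | b <- w],
                  forall j, T (Cnt s j) = home j (nseq (n s) [ffun=> false])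
                & forall i, untouched s i -> T i = F i])
    setup_cost.
Proof.
pose P1 r T := exists l d, [/\ d + r = n s,
  T (In J) = zipper l [seq Some b | b <- nseq r true ++ false :: w],
  forall j, T (Cnt s j) = Tape (nseq d (Some false)) None [::]
  & forall i, untouched s i -> T i = F i].
pose P2 r T := exists d, [/\ d + r = n s,
  exists l, T (In J) = zipper l [seq Some b | b <- w],
  forall j, T (Cnt s j) = Tape (behead (nseq r (Some false)))
    (head None (nseq r (Some false))) (nseq d (Some false) ++ [:: None])
  & forall i, untouched s i -> T i = F i].
apply: (@hoare_seq _ _ _ _ _ (P1 0)).
  apply: (@hoare_weaken _ _ _ _ (P1 (n s)) _ (P1 0)) => //.
    apply: (@hoare_while _ _ _ _ P1 _ _ 'X%R _ (n s)); last by rewrite hornerX.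
    - by move=> T [l [d [_ iE _ _]]]; rewrite ffunE iE.
    - by move=> r T [l [d [_ iE _ _]]]; rewrite ffunE iE.
    move=> r _; apply: hoare_do => T [l [d [dr iE cE fE]]].
    exists (Some true :: l), d.+1; split.
    - by rewrite -dr addnS.
    - by rewrite act_update /= ffunE iE.
    - by move=> j; rewrite act_update /= eqxx cE.
    move=> [[[[[s' j]|]|]|]|] //= /[dup] ns; rewrite -?fE // act_update //=.
    by rewrite (negPf ns).
  move=> T [[l iE] cE fE]; exists l, 0; split=> //.
  by rewrite iE /unary cat_rcons.
apply: (@hoare_seq _ _ _ _ _ (P2 (n s))).
  (* The input head is on the [false] that closes the unary number and moves past it, while the row
     heads turn back. *)
  apply: hoare_do => T [l [d [dr iE cE fE]]]; rewrite addn0 in dr.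
  rewrite dr in cE; exists 0; split=> //.
  - by exists (Some false :: l); rewrite act_update /= ffunE iE.
  - by move=> j; rewrite act_update /= eqxx ffunE cE.
  move=> [[[[[s' j]|]|]|]|] //= /[dup] ns; rewrite -?fE // act_update //=.
  by rewrite (negPf ns).
apply: (@hoare_seq _ _ _ _ _ (P2 0)).
  apply: (@hoare_while _ _ _ _ P2 _ _ 'X%R _ (n s)); last by rewrite hornerX.
  - by move=> T [d [_ _ cE _]]; rewrite /on_cells ffunE cE.
  - by move=> r T [d [_ _ cE _]]; rewrite /on_cells ffunE cE.
  move=> r _; apply: hoare_do => T [d [dr [l iE] cE fE]].
  exists d.+1; split.
  - by rewrite -dr addnS.
  - by exists l; rewrite act_update /= iE.
  - by move=> j; rewrite act_update /= eqxx ffunE cE.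
  move=> [[[[[s' j]|]|]|]|] //= /[dup] ns; rewrite -?fE // act_update //=.
  by rewrite (negPf ns).
apply: hoare_do => T [d [dr [l iE] cE fE]]; rewrite addn0 in dr; split.
- by exists l; rewrite act_update /= iE.
- move=> j; rewrite act_update /= eqxx ffunE cE dr /home /row map_nseq ffunE.
  by [].
move=> [[[[[s' j]|]|]|]|] //= /[dup] ns; rewrite -?fE // act_update //=.
by rewrite (negPf ns).
Qed.

(** The word on a tape is read from the head on, so the output head has to return to the first
    bit. *)
Definition rewind : prog (tid J) :=
  let mv d := Do (update_tapes (fun a i =>
    if i is Some None then Some (a i, d) else None)) in
  Seq (mv MoveL) (Seq (While (fun a => a (Out J) != None) (mv MoveL)) (mv MoveR)).

Definition rewind_cost (B : {poly nat}) : {poly nat} :=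
  (1 + (while_cost B 1 + 1))%R.

Lemma hoare_rewind out (B : {poly nat}) : size out <= B.[N]%R ->
  hoare (fun T => T (Out J) = Tape (rev [seq Some b | b <- out]) None [::]) rewind
    (fun T => word_of (T (Out J)) = out) (rewind_cost B).
Proof.
move=> le_out.
pose P r (T : tapes_of (tid J)) := exists l w, [/\ size l = r, rev l ++ w = out &
  T (Out J) = Tape (behead [seq Some b | b <- l]) (head None [seq Some b | b <- l])
                ([seq Some b | b <- w] ++ [:: None])].
apply: (@hoare_seq _ _ _ _ _ (P (size out))).
  apply: hoare_do => T oE; exists (rev out), [::].
  rewrite size_rev revK cats0; split=> //.
  by rewrite act_update /= ffunE oE map_rev.
apply: (@hoare_seq _ _ _ _ _ (P 0)).
  apply: hoare_while => //.
  - by move=> T [l [w [/size0nil-> _ oE]]]; rewrite ffunE oE.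
  - by move=> r T [[|b l] [w [//= _ _ oE]]]; rewrite ffunE oE.
  move=> r _; apply: hoare_do => T [[|b l] [w [//= [szl] lE oE]]].
  exists l, (b :: w); split=> //; first by rewrite -cat_rcons -rev_cons.
  by rewrite act_update /= ffunE oE.
apply: hoare_do => T [l [w [/size0nil-> /= wE oE]]].
by rewrite act_update /= ffunE oE -wE /word_of; case: (w) => //= b w'; rewrite take_word_cat.
Qed.

End Ends.

(** * The program that writes both graphs *)

Section Reduction.
Variable k : nat.
Notation J := (bool * 'I_k.+1)%type.
(** Group [false] holds the tuple of the vertex indexing the row of the adjacency matrix, group
    [true] that of the vertex indexing the column. *)
Definition group (g : bool) : seq J := [seq (g, l) | l <- enum 'I_k.+1].

Lemma size_group g : size (group g) = k.+1.
Proof. by rewrite size_map size_enum_ord. Qed.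

Lemma group_uniq g : uniq (group g).
Proof. by rewrite map_inj_uniq ?enum_uniq // => ? ? []. Qed.

Lemma notin_group g l : (g, l) \notin group (~~ g).
Proof. by apply/mapP => -[? _ []]; case: g. Qed.

(** In column [i] a row is marked when its coordinate equals [i]: [has] says that [i] occurs in the
    tuple, [all] that the tuple is constantly [i]. *)
Definition col_incident (c : option nat) g (x : column J) : bool :=
  match c with
  | None => true
  | Some c => if c == 0 then has x (group g) else all x (group g)
  end.

Definition col_queried (c : option nat) g (x : column J) : bool :=
  if c is Some c then (c == 0) && has x (group g) else false.

Variable L : nat.
Let j0 : J := (false, ord0).

Definition rows_of s (c : option nat) : prog (tid J) :=
  for_vertices j0 L s (group true) (fun d =>
    test j0 s
      (fun x => [&& joinable c d, col_incident c false x & col_incident d true x])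
      (fun x => col_queried c false x || col_queried d true x)).

(** The first loop over the vertices serves only to write their number in unary. *)
Definition write_graph s : prog (tid J) :=
  Seq (for_vertices j0 L s (group false) (fun _ => emit (fun=> true)))
    (Seq (emit (fun=> false)) (for_vertices j0 L s (group false) (rows_of s))).

Definition write_graph_cost : {poly nat} :=
  (for_vertices_cost L k.+1 1 +
   (1 + for_vertices_cost L k.+1 (for_vertices_cost L k.+1 test_cost)))%R.

Definition reduction : prog (tid J) :=
  Seq (Seq (setup j0 false) (Seq (setup j0 true)
        (Seq (write_graph false) (write_graph true))))
    (rewind J).

Definition write_cost : {poly nat} :=
  (setup_cost + (setup_cost + (write_graph_cost + write_graph_cost)))%R.

Definition reduction_cost : {poly nat} :=
  (write_cost + rewind_cost write_cost)%R.

Variables (O : pred (seq bool)) (N : nat) (n : bool -> nat).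
Hypothesis n_le : forall s, n s <= N.
Notation hoare := (hoare (Qry J) O N).

(** Adjacency as the machine computes it, with cell numbers for elements and the oracle for
    independence. *)
Definition adj_bit s (u v : option (nat * seq nat)) : bool :=
  has (fun i => [&& joinable (omap fst u) (omap fst v), incident u i & incident v i])
    (iota 0 (n s)) &&
  O (s :: [seq queried u i || queried v i | i <- iota 0 (n s)]).

Definition graph_word s : seq bool :=
  let vs := vertices L (iota 0 (n s)) k.+1 in
  unary (size vs) ++ [seq adj_bit s u v | u <- vs, v <- vs].

Definition blank : {ffun bool * J -> nat} := [ffun x => n x.1].

Lemma col_set_word (m : {ffun bool * J -> nat}) s g t i :
  size t = k.+1 -> forall x : column J,
  (forall j, j \in group g -> x j = (set_word m s (group g) t (s, j) == i)) ->
  (has x (group g) = (i \in t)) * (all x (group g) = all (pred1 i) t).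
Proof.
move=> szt x xE; have tE := map_set_word m s (group_uniq g) (etrans szt (esym (size_group g))).
split.
  rewrite (eq_in_has xE) -[in RHS]tE -has_pred1 [in RHS]has_map; by apply: eq_has.
by rewrite (eq_in_all xE) -[in RHS]tE [in RHS]all_map; by apply: eq_all.
Qed.

Lemma hoare_for_group (m : {ffun bool * J -> nat}) s g p B
    (w : option (nat * seq nat) -> seq bool) out :
  (forall j, j \in group g -> m (s, j) = n s) ->
  (forall v out, v \in vertices L (iota 0 (n s)) k.+1 ->
     hoare (st n (set_vertex m s (group g) v) out) (p (omap fst v))
       (st n (set_vertex m s (group g) v) (out ++ w v)) B) ->
  hoare (st n m out) (for_vertices j0 L s (group g) p)
    (st n m (out ++ flatten [seq w v | v <- vertices L (iota 0 (n s)) k.+1]))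
    (for_vertices_cost L k.+1 B).
Proof.
have := @hoare_for_vertices _ j0 O N n n_le L m s (group g) p B w out (group_uniq g).
by rewrite size_group; exact.
Qed.

Lemma hoare_write_graph s out :
  hoare (st n blank out) (write_graph s) (st n blank (out ++ graph_word s))
    write_graph_cost.
Proof.
have blankE g j : j \in group g -> blank (s, j) = n s by rewrite ffunE.
rewrite /graph_word /unary -cats1 -!catA catA.
set vs := vertices _ _ _.
apply: (@hoare_seq _ _ _ _ _ (st n blank (out ++ nseq (size vs) true))).
  have -> : nseq (size vs) true = flatten [seq [:: true] | v <- vs].
    by elim: (vs) => //= _ ? ->.
  apply: hoare_for_group; first exact: blankE.
  by move=> v out' _; exact: hoare_emit_bit.
apply: (@hoare_seq _ _ _ _ _ (st n blank ((out ++ nseq (size vs) true) ++ [:: false]))).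
  exact: hoare_emit_bit.
rewrite catA.
have -> : [seq adj_bit s u v | u <- vs, v <- vs] =
    flatten [seq flatten [seq [:: adj_bit s u v] | v <- vs] | u <- vs].
  congr flatten; apply/eq_map => u; elim: (vs) => //= ? ? ->; done.
apply: hoare_for_group; first exact: blankE.
move=> u out1 u_in; apply: hoare_for_group.
  move=> j jg; case: u {u_in} => [[c t]|] //=; last exact: (blankE true).
  rewrite set_word_notin ?(blankE true) //.
  by case/mapP: jg => l _ ->; rewrite (notin_group true) orbT.
move=> v out2 v_in; set m := set_vertex _ _ _ _.
have szE c t : Some (c, t) \in vertices L (iota 0 (n s)) k.+1 -> size t = k.+1.
  rewrite inE /= => /allpairsP[[c' t'] /= [_ tw [_ ->]]].
  by move: tw; rewrite mem_words => /andP[/eqP].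
(* The tuple of [v] is set in the other group of rows, so group [false] still shows that of [u]. *)
have inc_u i (x : column J) : x = [ffun j => m (s, j) == i] ->
    (col_incident (omap fst u) false x = incident u i) *
    (col_queried (omap fst u) false x = queried u i).
  move=> xE; case: u u_in @m xE => [[c t]|] //= u_in xE.
  have H j : j \in group false -> x j = (set_word blank s (group false) t (s, j) == i).
    case/mapP=> l _ ->; rewrite xE ffunE; case: (v) => [[d t']|] //=.
    by rewrite [in LHS]set_word_notin // (notin_group false) orbT.
  by rewrite !(col_set_word (szE _ _ u_in) H).
have inc_v i (x : column J) : x = [ffun j => m (s, j) == i] ->
    (col_incident (omap fst v) true x = incident v i) *
    (col_queried (omap fst v) true x = queried v i).
  clear inc_u => xE; case: v v_in @m xE => [[c t]|] //= v_in xE.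
  have H j : j \in group true -> x j =
      (set_word (set_vertex blank s (group false) u) s (group true) t (s, j) == i).
    by rewrite xE ffunE.
  by rewrite !(col_set_word (szE _ _ v_in) H).
have -> : adj_bit s u v =
  has (fun x => [&& joinable (omap fst u) (omap fst v),
     col_incident (omap fst u) false x & col_incident (omap fst v) true x]) (columns n m s) &&
  O (s :: [seq col_queried (omap fst u) false x || col_queried (omap fst v) true x
             | x <- columns n m s]).
  rewrite /adj_bit /columns has_map -map_comp; congr (_ && O (_ :: _)).
    by apply: eq_has => i /=; rewrite !(inc_u i _ erefl, inc_v i _ erefl).
  by apply: eq_map => i /=; rewrite !(inc_u i _ erefl, inc_v i _ erefl).
exact: hoare_test.
Qed.

Lemma exec_reduction :
  exists T t, [/\ exec (Qry J) O reduction
      [ffun i => tape_of (if i == In J then unary (n false) ++ unary (n true) else [::])] T t,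
    t <= reduction_cost.[N]%R
  & word_of (T (Out J)) = graph_word false ++ graph_word true].
Proof.
set T0 := [ffun i => _].
have colE s : columns n blank s = nseq (n s) [ffun=> false].
  apply: (@eq_from_nth _ [ffun=> false]) => [|i].
    by rewrite size_map size_iota size_nseq.
  rewrite size_map size_iota => i_lt.
  rewrite (nth_map 0) ?size_iota // nth_nseq i_lt nth_iota //.
  by apply/ffunP => j; rewrite !ffunE /= add0n; apply/negbTE/eqP; lia.
(* The tapes that the second [setup] leaves alone: the rows of the first side are in place, the
   others are empty. *)
pose F (i : tid J) := if i is Some (Some (Some (Some (_, j)))) then
  home j (nseq (n false) [ffun=> false]) else Tape [::] None [::].
have hw : hoare (fun T => T = T0) (Seq (setup j0 false) (Seq (setup j0 true)
        (Seq (write_graph false) (write_graph true))))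
    (st n blank (graph_word false ++ graph_word true)) write_cost.
  apply: hoare_seq.
    apply: hoare_weaken (@hoare_setup _ j0 O N n n_le false
      (fun=> Tape [::] None [::]) (unary (n true))) _ (fun T h => h).
    move=> T ->; split=> [|j|[[[[[s' j]|]|]|]|]] //=; rewrite !ffunE //.
    by exists [::]; rewrite eqxx /unary; case: (n false).
  apply: hoare_seq.
    apply: hoare_weaken (@hoare_setup _ j0 O N n n_le true F [::]) _ (fun T h => h).
    move=> T [[l iE] cE fE]; split=> [|j|].
    - by exists l; rewrite cats0.
    - exact: fE.
    - by move=> [[[[[[] j]|]|]|]|] //= _; rewrite ?cE ?fE.
  apply: (@hoare_seq _ _ _ _ _ (st n blank (graph_word false))).
    apply: hoare_weaken (@hoare_write_graph false [::]) _ (fun T h => h).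
    move=> T [_ cE fE]; split=> [s j||]; [rewrite colE|by rewrite fE..].
    by case: s; [exact: cE|rewrite fE].
  exact: hoare_write_graph.
have [T [t [eT le_t [_ oT _]]]] := hw T0 erefl.
(* Each step writes at most one cell, so the running time bounds the output. *)
have le_out : size (graph_word false ++ graph_word true) <= write_cost.[N]%R.
  apply: leq_trans le_t; have := exec_size_lft (Out J) eT.
  rewrite oT -[lft _]/(rev _) size_rev. by rewrite size_map ffunE.
have [T' [t' [eT' le_t' oT']]] := @hoare_rewind _ O N _ write_cost le_out T oT.
exists T', (t + t'); split=> //; first exact: ExecSeq eT eT'.
by rewrite hornerD leq_add.
Qed.

End Reduction.

(** * Isomorphisms and triangles in cycle matroids *)

Lemma dep_circuitP (T : finType) (M : matroid T) (A : {set T}) :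
  reflect (exists2 C, circuit M C & C \subset A) (A \notin indep M).
Proof.
apply: (iffP idP) => [dA|[C /minsetP[/= dC _] CA]].
  by have [C] := @minset_exists _ [pred A | A \notin indep M] A dA; exists C.
by apply: contra dC; apply: indep_sub.
Qed.

Lemma can_imset_id (S T : finType) (f : S -> T) (g : T -> S) (A : {set S}) :
  cancel f g -> g @: (f @: A) = A.
Proof. by move=> fK; rewrite -imset_comp -[RHS]imset_id; apply: eq_imset. Qed.

(** Circuits are the minimal dependent sets, and the dependent sets are those that contain a
    circuit, so a bijection respects both or neither. *)
Lemma matroid_isoP (T1 T2 : finType) (M1 : matroid T1) (M2 : matroid T2) :
  matroid_iso M1 M2 <->
  exists2 f : T1 -> T2, bijective f
    & forall A : {set T1}, (f @: A \in indep M2) = (A \in indep M1).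
Proof.
split=> -[f f_bij fP]; exists f => //; have [g fK gK] := f_bij.
  move=> A; apply/idP/idP; apply: contraLR => /dep_circuitP[C cC CA]; apply/dep_circuitP.
    by exists (f @: C); [exact/fP|exact: imsetS].
  exists (g @: C); first by apply/fP; rewrite can_imset_id.
  by rewrite -(can_imset_id A fK) imsetS.
move=> C; split=> /minsetP[/= dC minC]; apply/minsetP => /=; rewrite ?fP in dC *.
  split=> // B dB BC; rewrite -(minC (g @: B)) ?can_imset_id //.
    by rewrite -fP can_imset_id.
  by rewrite -(can_imset_id C fK) imsetS.
split=> // B; rewrite -fP => /minC fB BC.
by rewrite -(can_imset_id B fK) fB ?can_imset_id // imsetS.
Qed.

Lemma imset_pair (S T : finType) (f : S -> T) u v :
  f @: [set u; v] = [set f u; f v].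
Proof. by rewrite imsetU !imset_set1. Qed.

Lemma edge_map_subproof (X Y : sgraph) (g : 'I_(nv X) -> 'I_(nv Y)) :
  (forall u v, adj u v -> adj (g u) (g v)) ->
  forall e : edge X, g @: val e \in edges Y.
Proof.
move=> gP e; have [[u v] eE] := edge_ends e; rewrite eE imset_pair.
by apply: gP; rewrite /adj -eE (valP e).
Qed.

Definition edge_map (X Y : sgraph) (g : 'I_(nv X) -> 'I_(nv Y)) gP (e : edge X) : edge Y :=
  Sub (g @: val e) (@edge_map_subproof X Y g gP e).

Lemma edge_map_cycle (X Y : sgraph) (g : 'I_(nv X) -> 'I_(nv Y)) gP
    (C : {set edge X}) : injective g -> injective (@edge_map X Y g gP) ->
  is_cycle C -> is_cycle (edge_map gP @: C).
Proof.
move=> g_inj F_inj /is_cycleP[c /and3P[szc uc cc] ->].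
apply/is_cycleP; exists (map g c).
  rewrite /simple_cycle size_map szc map_inj_uniq // uc /=.
  by rewrite cycle_map; apply: sub_cycle cc.
apply/setP => e; rewrite [RHS]inE; apply/imsetP/existsP.
  case=> e'; rewrite inE => /existsP[x /andP[xc /eqP e'E]] ->.
  by exists (g x); rewrite map_f //= next_map // e'E imset_pair.
case=> y /andP[/mapP[x xc ->]]; rewrite next_map // => /eqP eE.
have xn : [set x; next c x] \in edges X by apply: next_cycle cc xc.
exists (Sub [set x; next c x] xn : edge X).
  by rewrite inE; apply/existsP; exists x; rewrite xc SubK eqxx.
by apply: val_inj; rewrite /= eE imset_pair.
Qed.

Lemma graph_iso_matroid_iso (X Y : sgraph) (g : 'I_(nv X) -> 'I_(nv Y)) h :
  cancel g h -> cancel h g -> (forall u v, adj (g u) (g v) = adj u v) ->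
  matroid_iso (cycle_matroid X) (cycle_matroid Y).
Proof.
move=> gK hK gP.
have gP1 u v : adj u v -> adj (g u) (g v) by rewrite gP.
have hP1 u v : adj u v -> adj (h u) (h v) by rewrite -gP !hK.
have FK : cancel (edge_map gP1) (edge_map hP1).
  by move=> e; apply: val_inj; rewrite /= can_imset_id.
have GK : cancel (edge_map hP1) (edge_map gP1).
  by move=> e; apply: val_inj; rewrite /= can_imset_id.
exists (edge_map gP1); first by exists (edge_map hP1).
move=> C; rewrite !circuit_cycle_matroid; split.
  by apply: edge_map_cycle; apply: can_inj; eassumption.
move=> /(edge_map_cycle (can_inj hK) (can_inj GK)).
by rewrite can_imset_id.
Qed.

(** * Circuits of size three *)

Section Triangles.
Variable X : sgraph.
Implicit Types (C : {set edge X}) (e : edge X).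

Definition triangle C : bool := circuit (cycle_matroid X) C && (#|C| == 3).

(** Sending a vertex to the edge towards its successor is injective: two vertices with the same edge
    would each follow the other, which [next_neq_prev] excludes. *)
Lemma size_simple_cycle (c : seq 'I_(nv X)) :
  simple_cycle c -> size c <= #|cycle_edges c|.
Proof.
move=> /and3P[szc uc cc].
pose f (x : 'I_(nv X)) := [set x; next c x].
have f_inj : {in [set x in c] &, injective f}.
  move=> x y; rewrite !inE => xc yc /set2_inj[[]//|[xE yE]].
  have := next_neq_prev szc uc xc; rewrite yE.
  by rewrite [in prev _ _]xE prev_next // eqxx.
have -> : size c = #|f @: [set x in c]|.
  by rewrite card_in_imset // cardsE (card_uniqP uc).
rewrite -(card_imset (mem (cycle_edges c)) val_inj); apply/subset_leq_card/subsetP.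
move=> y /imsetP[x]; rewrite inE => xc ->{y}.
have xn : [set x; next c x] \in edges X by apply: next_cycle cc xc.
apply/imsetP; exists (Sub [set x; next c x] xn : edge X); last by rewrite SubK.
by rewrite inE; apply/existsP; exists x; rewrite xc SubK eqxx.
Qed.

Lemma cycle_edges3 u v w e1 e2 e3 : uniq [:: u; v; w] ->
  val e1 = [set u; v] -> val e2 = [set v; w] -> val e3 = [set w; u] ->
  cycle_edges [:: u; v; w] = [set e1; e2; e3].
Proof.
rewrite /= !inE negb_or andbT => /andP[/andP[uv uw] vw] e1E e2E e3E.
have nu : next [:: u; v; w] u = v by rewrite /= eqxx.
have nv' : next [:: u; v; w] v = w by rewrite /= [v == u]eq_sym (negPf uv) eqxx.
have nw : next [:: u; v; w] w = u.
  by rewrite /= [w == u]eq_sym (negPf uw) [w == v]eq_sym (negPf vw) eqxx.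
apply/setP => e; rewrite !inE; apply/existsP/idP.
  case=> x /andP[]; rewrite !inE => /or3P[]/eqP->; rewrite (nu, nv', nw).
  - by rewrite -e1E => /eqP/val_inj->; rewrite eqxx.
  - by rewrite -e2E => /eqP/val_inj->; rewrite eqxx orbT.
  - by rewrite -e3E => /eqP/val_inj->; rewrite eqxx orbT.
case/orP=> [/orP[]|] /eqP->; [exists u|exists v|exists w];
  by rewrite ?nu ?nv' ?nw !inE !eqxx ?orbT; apply/eqP.
Qed.

(** By [size_simple_cycle] a circuit with three edges comes from a cycle on exactly three vertices.
    Conversely the vertices are distinct because every edge has two ends. *)
Lemma triangleP C : reflect
  (exists u v w e1 e2 e3, [/\ val e1 = [set u; v], val e2 = [set v; w],
      val e3 = [set w; u] & C = [set e1; e2; e3]])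
  (triangle C).
Proof.
apply: (iffP andP) => [[]|].
  rewrite circuit_cycle_matroid => /is_cycleP[c sc ->] /eqP C3.
  have := size_simple_cycle sc; rewrite C3.
  have /and3P[szc uc cc] := sc.
  move: c szc uc cc {sc C3} => [|u [|v [|w [|? ?]]]] //= _ uc /and4P[uv vw wu _] _.
  exists u, v, w, (Sub [set u; v] uv), (Sub [set v; w] vw), (Sub [set w; u] wu).
  by split; rewrite ?SubK //; apply: cycle_edges3.
case=> u [v [w [e1 [e2 [e3 [e1E e2E e3E ->]]]]]].
have uc : uniq [:: u; v; w].
  rewrite /= !inE negb_or (ends_neq e1E) (ends_neq e2E).
  by rewrite eq_sym (ends_neq e3E).
have sc : simple_cycle [:: u; v; w].
  rewrite /simple_cycle uc /= /adj -e1E -e2E -e3E.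
  by apply/and4P; split=> //; apply: valP.
rewrite circuit_cycle_matroid -(cycle_edges3 uc e1E e2E e3E); split.
  by apply/is_cycleP; exists [:: u; v; w].
rewrite eqn_leq (size_simple_cycle sc) (cycle_edges3 uc e1E e2E e3E) andbT.
by rewrite (leq_trans (leq_card_setU _ _)) // cards1 addn1 ltnS cards2; case: (_ != _).
Qed.

Definition triangles_of e : {set {set edge X}} := [set C | triangle C & e \in C].

End Triangles.

Lemma card_triangles_of (X Y : sgraph) (F : edge X -> edge Y) G e :
  cancel F G -> cancel G F ->
  (forall C : {set edge X}, triangle (F @: C) = triangle C) ->
  #|triangles_of (F e)| = #|triangles_of e|.
Proof.
move=> FK GK Ftri; have F_inj := can_inj FK.
rewrite -(card_imset (mem (triangles_of e)) (imset_inj F_inj)).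
apply: eq_card => C; apply/idP/imsetP => [|[D]].
  rewrite inE => /andP[tC eC]; exists (G @: C); last by rewrite can_imset_id.
  rewrite inE -Ftri can_imset_id // tC /=.
  by rewrite -(FK e) imset_f.
by rewrite !inE => /andP[tD eD] ->; rewrite Ftri tD imset_f.
Qed.

(** * Graphs on a list of vertices *)

Section ListGraph.
Variables (V : eqType) (vs : seq V) (E : rel V).
Hypotheses (vs_uniq : uniq vs) (E_sym : symmetric E) (E_irr : irreflexive E).

Definition label (i : 'I_(size vs)) : V := tnth (in_tuple vs) i.

Lemma label_inj : injective label.
Proof.
move=> i j; rewrite /label !(tnth_nth (label i)) /= => /eqP.
by rewrite nth_uniq // => /eqP/val_inj.
Qed.

Lemma label_mem i : label i \in vs.
Proof. exact: mem_tnth. Qed.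

Lemma labelP v : v \in vs -> exists i, label i = v.
Proof. by case/seq_tnthP=> i ->; exists i. Qed.

Definition list_edges : {set {set 'I_(size vs)}} :=
  [set e | [exists u, exists v, (e == [set u; v]) && E (label u) (label v)]].

Lemma list_edges_card2 e : e \in list_edges -> #|e| = 2.
Proof.
rewrite inE => /existsP[u /existsP[v /andP[/eqP-> uv]]]; rewrite cards2.
by case: eqP uv => // ->; rewrite E_irr.
Qed.

Definition list_graph := SGraph list_edges_card2.

Lemma adj_list_graph u v : @adj list_graph u v = E (label u) (label v).
Proof.
rewrite /adj inE; apply/existsP/idP => [[u' /existsP[v' /andP[/eqP]]]|uv].
  by move/(@set2_inj list_graph) => [[-> ->]|[-> ->]] //; rewrite E_sym.
by exists u; apply/existsP; exists v; rewrite eqxx.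
Qed.

Lemma encode_list_graph :
  encode_graph list_graph = unary (size vs) ++ [seq E u v | u <- vs, v <- vs].
Proof.
rewrite /encode_graph /=; congr (_ ++ _).
have vsE : map label (enum 'I_(size vs)) = vs := map_tnth_enum (in_tuple vs).
rewrite -[in RHS]vsE allpairs_mapl allpairs_mapr; congr flatten.
by apply: eq_map => u; apply: eq_map => v; apply: adj_list_graph.
Qed.

(** Allows reasoning about edges through the vertices in the list, without their indices. *)
Definition joins_labels (e : edge list_graph) a b : Prop :=
  exists i j, [/\ val e = [set i; j], label i = a & label j = b].

Lemma joins_labels_sym e a b : joins_labels e a b -> joins_labels e b a.
Proof. by case=> i [j [eE ? ?]]; exists j, i; rewrite eE setUC. Qed.

Lemma joins_labels_ex e : exists a b, joins_labels e a b.
Proof. by have [[i j] eE] := edge_ends e; exists (label i), (label j), i, j. Qed.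

Lemma joins_labelsE e a b :
  joins_labels e a b -> [/\ a \in vs, b \in vs & E a b].
Proof.
case=> i [j [eE <- <-]]; rewrite !label_mem; split=> //.
by rewrite -adj_list_graph /adj -eE (valP e).
Qed.

Lemma joins_labels_mk a b : a \in vs -> b \in vs -> E a b ->
  exists e, joins_labels e a b.
Proof.
move=> /labelP[i <-] /labelP[j <-]; rewrite -adj_list_graph => ij.
by exists (Sub [set i; j] ij), i, j.
Qed.

Lemma joins_labels_inj e f a b :
  joins_labels e a b -> joins_labels f a b -> e = f.
Proof.
case=> i [j [eE <- <-]] [i' [j' [fE /label_inj iE /label_inj jE]]].
by apply: val_inj; rewrite eE fE iE jE.
Qed.

Lemma joins_labels_ends e a b c d : joins_labels e a b -> joins_labels e c d ->
  (a = c /\ b = d) \/ (a = d /\ b = c).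
Proof.
case=> i [j [eE <- <-]] [i' [j' [fE <- <-]]]; move: fE; rewrite eE.
by case/(@set2_inj list_graph)=> -[-> ->]; [left|right].
Qed.

Lemma triangle_labelsP (C : {set edge list_graph}) : reflect
  (exists a b c e1 e2 e3, [/\ joins_labels e1 a b, joins_labels e2 b c,
      joins_labels e3 c a & C = [set e1; e2; e3]])
  (triangle C).
Proof.
apply: (iffP (triangleP C)).
  case=> u [v [w [e1 [e2 [e3 [e1E e2E e3E CE]]]]]].
  exists (label u), (label v), (label w), e1, e2, e3; split=> //.
  - by exists u, v.
  - by exists v, w.
  - by exists w, u.
case=> a [b [c [e1 [e2 [e3 [
  [u [v [e1E uE vE]]] [v' [w [e2E vE' wE]]] [w' [u' [e3E wE' uE']]] CE]]]]]].
exists u, v, w, e1, e2, e3; split=> //.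
  by rewrite e2E -(label_inj (etrans vE (esym vE'))).
by rewrite e3E -(label_inj (etrans wE (esym wE'))) -(label_inj (etrans uE (esym uE'))).
Qed.

End ListGraph.

Lemma list_graph_matroid_iso (V W : eqType) (vs : seq V) (ws : seq W)
    (E : rel V) (F : rel W) (vs_uniq : uniq vs) (ws_uniq : uniq ws)
    (E_sym : symmetric E) (F_sym : symmetric F)
    (E_irr : irreflexive E) (F_irr : irreflexive F) (g : V -> W) h :
  cancel g h -> cancel h g ->
  {in vs, forall v, g v \in ws} -> {in ws, forall w, h w \in vs} ->
  (forall u v, F (g u) (g v) = E u v) ->
  matroid_iso (cycle_matroid (list_graph vs E_irr)) (cycle_matroid (list_graph ws F_irr)).
Proof.
move=> gK hK gvs hws gE.
have [g' g'P] : exists g' : 'I_(size vs) -> 'I_(size ws), forall i, label (g' i) = g (label i).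
  apply: (@fin_all_exists _ (fun=> 'I_(size ws)) (fun i j => label j = g (label i))) => i.
  exact/labelP/gvs/label_mem.
have [h' h'P] : exists h' : 'I_(size ws) -> 'I_(size vs), forall i, label (h' i) = h (label i).
  apply: (@fin_all_exists _ (fun=> 'I_(size vs)) (fun i j => label j = h (label i))) => i.
  exact/labelP/hws/label_mem.
apply: (@graph_iso_matroid_iso (list_graph vs E_irr) (list_graph ws F_irr) g' h').
- by move=> i; apply: (label_inj vs_uniq); rewrite h'P g'P gK.
- by move=> i; apply: (label_inj ws_uniq); rewrite g'P h'P hK.
by move=> u v; rewrite !adj_list_graph // !g'P gE.
Qed.

(** * Recovering a matroid from its graph *)

(** Counting along a relation: triangles can be compared with elements or blocks without defining a
    map from one to the other. *)
Lemma card_le_rel (S T : finType) (A : {set S}) (B : {set T}) (R : S -> T -> Prop) :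
  (forall x, x \in A -> exists2 y, y \in B & R x y) ->
  (forall x x' y, x \in A -> x' \in A -> R x y -> R x' y -> x = x') ->
  #|A| <= #|B|.
Proof.
move=> AB R_inj.
have [f fP] : exists f : {x | x \in A} -> T, forall x, f x \in B /\ R (val x) (f x).
  apply: (@fin_all_exists _ (fun=> T) (fun x y => y \in B /\ R (val x) y)) => x.
  by have [y yB Rxy] := AB _ (valP x); exists y.
have f_inj : injective f.
  move=> x y fxy; apply: val_inj; apply: (R_inj _ _ (f x)); rewrite ?(valP x) ?(valP y) //.
    by case: (fP x).
  by rewrite fxy; case: (fP y).
have -> : #|A| = #|{: {x | x \in A}}| by rewrite card_sig; apply: eq_card.
rewrite -cardsT -(card_imset _ f_inj); apply/subset_leq_card/subsetP.
by move=> _ /imsetP[x _ ->]; case: (fP x).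
Qed.

Lemma all_pred1_nseq (T : eqType) (x : T) (t : seq T) :
  all (pred1 x) t -> t = nseq (size t) x.
Proof. by move/all_pred1P. Qed.

Section MatroidGraph.
Variables (b n : nat) (M : matroid 'I_n).
Notation vertex := (option (nat * seq 'I_n)).
Implicit Types (u v w : vertex) (x y : 'I_n) (S : {set 'I_n}).

(** The [b.+4] kinds are that of blocks, that of elements and [b.+2] kinds of pendants. *)
Definition mvertices : seq vertex := vertices b.+4 (enum 'I_n) b.+1.

Definition madj u v : bool :=
  [exists i : 'I_n, [&& joinable (omap fst u) (omap fst v), incident u i & incident v i]] &&
  ([set i : 'I_n | queried u i || queried v i] \in indep M).

Lemma mvertices_uniq : uniq mvertices.
Proof.
rewrite /mvertices /vertices cons_uniq; apply/andP; split.
  by apply/negP => /allpairsP[? []].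
apply: allpairs_uniq; rewrite ?iota_uniq ?words_uniq ?enum_uniq //.
by move=> [? ?] [? ?] _ _ /= [-> ->].
Qed.

Lemma mem_mvertices c t :
  (Some (c, t) \in mvertices) = (c < b.+4) && (size t == b.+1).
Proof.
have -> : (c < b.+4) = (c \in iota 0 b.+4) by rewrite mem_iota.
have -> : (size t == b.+1) = (t \in words (enum 'I_n) b.+1).
  rewrite mem_words; apply/esym/andb_idr => _; apply/allP => x _.
  by rewrite /= mem_enum.
rewrite inE; apply/allpairsP/andP => [[p [p1 p2 [-> ->]]]|[cL szt]] //.
by exists (c, t).
Qed.

Lemma madj_sym : symmetric madj.
Proof.
move=> u v; rewrite /madj; congr (_ && _).
  have jE : joinable (omap fst u) (omap fst v) = joinable (omap fst v) (omap fst u).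
    by case: u v => [[c ?]|] [[d ?]|] //=; rewrite eq_sym.
  by apply/existsP/existsP => -[i /and3P[uv ui vi]]; exists i; apply/and3P; split;
    rewrite // ?jE // -jE.
by under eq_finset do rewrite orbC.
Qed.

Lemma madj_irr : irreflexive madj.
Proof.
move=> u; rewrite /madj; apply/negbTE; rewrite negb_and; apply/orP; left.
by apply/existsPn => i; case: u => [[c t]|] //=; rewrite eqxx.
Qed.

Definition elt x : vertex := Some (1, nseq b.+1 x).
(** From here on pendants count as blocks, with empty support: this is the whole side opposite to
    the elements. *)
Definition block w : bool := if w is Some (d, _) then d != 1 else false.
Definition support w : {set 'I_n} := [set i : 'I_n | queried w i].

Lemma set0_indep : set0 \in indep M.
Proof. by have /set0Pn[A /(indep_sub (sub0set A))] := indep_neq0 M. Qed.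

Lemma elt_mem x : elt x \in mvertices.
Proof. by rewrite mem_mvertices size_nseq eqxx. Qed.

Lemma elt_inj : injective elt.
Proof. by move=> x y []. Qed.

Lemma madj_hub u :
  madj None u = [&& u != None, [exists i : 'I_n, incident u i] & support u \in indep M].
Proof.
rewrite /madj andbA; congr (_ && _).
by case: u => [[c t]|] //=; apply/existsP => -[].
Qed.

Lemma madj_hub_elt x : madj None (elt x).
Proof.
rewrite madj_hub /=; apply/andP; split.
  by apply/existsP; exists x; rewrite /= all_nseq /= eqxx ?orbT.
by have -> : support (elt x) = set0; [apply/setP => i; rewrite !inE|exact: set0_indep].
Qed.

Lemma madj_elt x w : block w -> madj (elt x) w = incident w x && (support w \in indep M).
Proof.
case: w => [[d s]|] //= /negPf d1; rewrite /madj; congr (_ && _) => //.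
apply/existsP/idP => [[i /=]|xs].
  by rewrite d1 /= => /andP[/andP[/eqP-> _]].
by exists x; rewrite /= d1 eqxx /= all_nseq /= eqxx ?orbT.
Qed.

(** A vertex of kind 1 with a neighbour is incident with some [x], which forces its tuple to be
    constant. *)
Lemma elt_shape t u : Some (1, t) \in mvertices -> madj u (Some (1, t)) ->
  exists x, Some (1, t) = elt x.
Proof.
rewrite mem_mvertices => /andP[_ /eqP szt] /andP[/existsP[x /and3P[_ _ /= tx]] _].
by exists x; rewrite /elt -szt -(all_pred1_nseq tx).
Qed.

Notation X := (list_graph mvertices madj_irr).
Notation jl := (@joins_labels _ mvertices madj madj_irr).
Implicit Types (e f : edge X) (C : {set edge X}).

(** The spokes: edges from the hub to the elements. *)
Variable sp : 'I_n -> edge X.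
Hypothesis spP : forall x, jl (sp x) None (elt x).

Let jlE e u v := joins_labelsE madj_sym (e := e) (a := u) (b := v).
Let jl_inj := joins_labels_inj mvertices_uniq (E_irr := madj_irr).

(** Away from the hub the graph is bipartite, so an edge that is not a spoke joins a block to the
    hub or to an element. *)
Lemma edge_casesP e : (exists x, e = sp x) \/
  (exists2 w, block w & jl e None w \/ exists x, jl e (elt x) w).
Proof.
have [u [v euv]] := joins_labels_ex e.
have one_sided c t d s : c == 1 -> d != 1 -> jl e (Some (c, t)) (Some (d, s)) ->
    exists2 w, block w & jl e None w \/ exists x, jl e (elt x) w.
  move=> /eqP-> d1 euv'; exists (Some (d, s)) => //; right.
  have [ut _ uv] := jlE euv'; rewrite madj_sym in uv.
  by have [x xE] := elt_shape ut uv; exists x; rewrite -xE.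
have hub c t : jl e None (Some (c, t)) -> (exists x, e = sp x) \/
    exists2 w, block w & jl e None w \/ exists x, jl e (elt x) w.
  have [->|c1] := eqVneq c 1 => euv'.
    have [_ vt uv] := jlE euv'; have [x xE] := elt_shape vt uv.
    by left; exists x; rewrite xE in euv'; exact: jl_inj euv' (spP x).
  by right; exists (Some (c, t)) => //; left.
case: u v euv => [[c t]|] [[d s]|] euv.
- have [_ _ /andP[/existsP[i /and3P[/= cd _ _]] _]] := jlE euv; right.
  have [c1|c1] := boolP (c == 1); last have [d1|d1] := boolP (d == 1).
  + by apply: one_sided euv => //; move: cd; rewrite c1; case: (d == 1).
  + exact: one_sided (joins_labels_sym euv).
  + by rewrite (negPf c1) (negPf d1) in cd.
- exact: hub (joins_labels_sym euv).
- exact: hub euv.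
- by have [_ _] := jlE euv; rewrite madj_hub.
Qed.

Lemma triangle_hub e1 e2 e3 v w : jl e1 None v -> jl e2 v w -> jl e3 w None ->
  exists x w f g, [/\ block w, jl f None w, jl g (elt x) w
    & [set e1; e2; e3] = [set sp x; f; g]].
Proof.
move=> j1 j2 j3.
case: v j1 j2 => [[c t]|] j1 j2; last by have [_ _] := jlE j1; rewrite madj_hub.
case: w j2 j3 => [[d s]|] j2 j3; last by have [_ _] := jlE j3; rewrite madj_hub.
have [vm wm /andP[/existsP[i /and3P[/= cd _ _]] _]] := jlE j2.
have [c1|c1] := eqVneq c 1.
  have d1 : d != 1 by move: cd; rewrite c1 eqxx; case: (d == 1).
  rewrite c1 in j1 j2 vm; have [_ _ j1E] := jlE j1.
  have [x xE] := elt_shape vm j1E; rewrite xE in j1 j2.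
  exists x, (Some (d, s)), e3, e2; split=> //; first exact: joins_labels_sym.
  by rewrite (jl_inj j1 (spP x)) setUAC.
have d1 : d = 1 by move: cd; rewrite (negPf c1); case: (d =P 1).
rewrite d1 in j2 j3 wm; have [_ _ j2E] := jlE j2.
have [x xE] := elt_shape wm j2E; rewrite xE in j2 j3.
exists x, (Some (c, t)), e1, e2; split=> //; first exact: joins_labels_sym.
by rewrite (jl_inj (joins_labels_sym j3) (spP x)) setUC setUA.
Qed.

(** A bipartite graph has no triangle, so the hub is one of the three vertices; a rotation makes it
    the first. *)
Lemma triangleE C : triangle C -> exists x w f g,
  [/\ block w, jl f None w, jl g (elt x) w & C = [set sp x; f; g]].
Proof.
move=> /(triangle_labelsP mvertices_uniq)[u [v [w [e1 [e2 [e3 [j1 j2 j3 ->]]]]]]].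
case: u j1 j3 => [[c t]|] j1 j3; last exact: triangle_hub j1 j2 j3.
case: v j1 j2 => [[d s]|] j1 j2; last first.
  have -> : [set e1; e2; e3] = [set e2; e3; e1] by rewrite -setUA setUC.
  exact: triangle_hub j2 j3 j1.
case: w j2 j3 => [[d' s']|] j2 j3; last first.
  have -> : [set e1; e2; e3] = [set e3; e1; e2] by rewrite setUC setUA.
  exact: triangle_hub j3 j1 j2.
(* Without the hub, three vertices would lie pairwise on opposite sides of the bipartition. *)
have [_ _ /andP[/existsP[i1 /and3P[/= + _ _]] _]] := jlE j1.
have [_ _ /andP[/existsP[i2 /and3P[/= + _ _]] _]] := jlE j2.
have [_ _ /andP[/existsP[i3 /and3P[/= + _ _]] _]] := jlE j3.
by case: (c == 1); case: (d == 1); case: (d' == 1).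
Qed.

Lemma triangle_mk x w f g : jl f None w -> jl g (elt x) w -> triangle [set sp x; f; g].
Proof.
move=> jf jg; apply/(triangle_labelsP mvertices_uniq).
exists (elt x), None, w, (sp x), f, g; split=> //; apply: joins_labels_sym => //.
Qed.

(** The edges from [w] to the hub and to an incident element both require the support of [w] to be
    independent, so the second brings the first. *)
Lemma triangle_ex x w : w \in mvertices -> block w -> madj (elt x) w ->
  exists f g, [/\ jl f None w, jl g (elt x) w & triangle [set sp x; f; g]].
Proof.
move=> wm wb xw; have := xw; rewrite madj_elt // => /andP[wx ws].
have hw : madj None w.
  rewrite madj_hub ws andbT; case: (w) wb wx => //= -[d s] _ wx.
  by apply/existsP; exists x.
have [f jf] := joins_labels_mk madj_sym madj_irr (mem_head None _ : None \in mvertices) wm hw.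
have [g jg] := joins_labels_mk madj_sym madj_irr (elt_mem x) wm xw.
by exists f, g; split=> //; exact: triangle_mk jf jg.
Qed.

Lemma sp_inj : injective sp.
Proof.
move=> x y xy; have := spP y; rewrite -xy => /(joins_labels_ends (spP x)).
by case=> -[] // _ /elt_inj.
Qed.

Lemma sp_block x w f : block w -> jl f None w -> sp x != f.
Proof.
move=> wb jf; apply/eqP => E; move: jf; rewrite -E.
by case/(joins_labels_ends (spP x)) => -[] // _ wE; rewrite -wE in wb.
Qed.

Lemma sp_cross x y w g : block w -> jl g (elt y) w -> sp x != g.
Proof.
move=> wb jg; apply/eqP => E; move: jg; rewrite -E.
by case/(joins_labels_ends (spP x)) => -[] // wE; rewrite -wE in wb.
Qed.

Lemma block_cross x v w f g : block v -> block w -> jl f None v -> jl g (elt x) w -> f != g.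
Proof.
move=> vb wb jf jg; apply/eqP => E; move: jg; rewrite -E.
by case/(joins_labels_ends jf) => -[] // wE; rewrite -wE in wb.
Qed.

Lemma triangle_spokeE x C : triangle C -> sp x \in C -> exists w f g,
  [/\ block w, jl f None w, jl g (elt x) w & C = [set sp x; f; g]].
Proof.
move=> /triangleE[y [w [f [g [wb jf jg ->]]]]]; rewrite !inE.
rewrite (negPf (sp_block _ wb jf)) (negPf (sp_cross _ wb jg)) !orbF.
by move=> /eqP/sp_inj->; exists w, f, g.
Qed.

(** The edge [f] determines the block and the spoke the element, hence together the third edge. *)
Lemma triangle_blockE x w f C : triangle C -> sp x \in C -> f \in C ->
  block w -> jl f None w -> exists2 g, jl g (elt x) w & C = [set sp x; f; g].
Proof.
move=> tC xC fC wb jf; have [v [f' [g [vb jf' jg CE]]]] := triangle_spokeE tC xC.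
move: fC; rewrite CE !inE (negPf (block_cross wb vb jf jg)).
rewrite eq_sym (negPf (sp_block x wb jf)) orbF /= => /eqP ff'.
have vw : v = w.
  rewrite -ff' in jf'.
  by case: (joins_labels_ends jf jf') => [[_ ->]|[_ wE]] //; rewrite wE in wb.
by exists g; rewrite ?ff' // -vw.
Qed.

Lemma triangle_crossE x y w g C : triangle C -> sp x \in C -> g \in C ->
  block w -> jl g (elt y) w ->
  y = x /\ exists2 f, jl f None w & C = [set sp x; f; g].
Proof.
move=> tC xC gC wb jg; have [v [f [g' [vb jf jg' CE]]]] := triangle_spokeE tC xC.
move: gC; rewrite CE !inE eq_sym (negPf (sp_cross x wb jg)) eq_sym.
rewrite (negPf (block_cross vb wb jf jg)) /= => /eqP gg'; rewrite -gg' in jg'.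
case: (joins_labels_ends jg jg') => -[]; last first.
  by move=> vE; rewrite -vE in vb.
move=> /elt_inj yx wv; split=> //; exists f; first by rewrite wv.
by rewrite gg'.
Qed.

(** Expressed by triangles and spokes alone, hence preserved by every isomorphism of cycle matroids
    that respects spokes. *)
Definition neighbours e : {set 'I_n} :=
  [set x | [exists C, [&& triangle C, e \in C & sp x \in C]]].

Lemma neighboursP e x : reflect (exists C, [/\ triangle C, e \in C & sp x \in C])
  (x \in neighbours e).
Proof.
rewrite inE; apply: (iffP existsP) => [[C /and3P[]]|[C [? ? ?]]]; exists C => //.
exact/and3P.
Qed.

Lemma neighbours_block w f : block w -> jl f None w ->
  neighbours f = [set x | incident w x].
Proof.
move=> wb jf; apply/setP => x; rewrite [RHS]inE; apply/neighboursP/idP.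
  case=> C [tC fC xC]; have [g jg _] := triangle_blockE tC xC fC wb jf.
  by have [_ _] := jlE jg; rewrite madj_elt // => /andP[].
move=> wx; have [_ wm] := jlE jf; rewrite madj_hub => /and3P[_ _ ws].
have xw : madj (elt x) w by rewrite madj_elt // wx.
have [f' [g [jf' jg tC]]] := triangle_ex wm wb xw.
exists [set sp x; f; g]; rewrite (jl_inj jf jf'); split=> //; rewrite !inE eqxx ?orbT //.
Qed.

Lemma neighbours_cross x w g : block w -> jl g (elt x) w -> neighbours g \subset [set x].
Proof.
move=> wb jg; apply/subsetP => y /neighboursP[C [tC gC yC]].
by have [-> _] := triangle_crossE tC yC gC wb jg; rewrite inE.
Qed.

Lemma card_incident w : block w -> w \in mvertices ->
  #|[set x | incident w x]| <= b.+1.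
Proof.
case: w => [[d s]|] //= _; rewrite mem_mvertices => /andP[_ /eqP szs].
rewrite -szs; apply: leq_trans (card_size s); apply/subset_leq_card/subsetP => x.
rewrite inE /=; case: ifP => // _.
by case: s szs => //= y s _ /andP[/eqP-> _]; rewrite mem_head.
Qed.

(** A triangle through [e] is determined by its spoke, so there are at most as many as neighbours of
    [e]. These are the elements incident with a tuple of length [b.+1], or at most one element if
    [e] joins an element to a block. *)
Lemma triangles_of_nonspoke e : (forall x, e != sp x) -> #|triangles_of e| <= b.+1.
Proof.
move=> eN; have [[x /eqP ex]|[w wb ew]] := edge_casesP e.
  by rewrite (negPf (eN x)) in ex.
apply: (@leq_trans #|neighbours e|).
  apply: (@card_le_rel _ _ _ _ (fun C x => sp x \in C)) => [C|C C' x].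
    rewrite inE => /andP[tC eC]; have [x [v [f [g [_ _ _ CE]]]]] := triangleE tC.
    have xC : sp x \in C by rewrite CE !inE eqxx.
    by exists x => //; apply/neighboursP; exists C.
  rewrite !inE => /andP[tC eC] /andP[tC' eC'] xC xC'; case: ew => [je|[y je]].
    have [g jg ->] := triangle_blockE tC xC eC wb je.
    by have [g' jg' ->] := triangle_blockE tC' xC' eC' wb je; rewrite (jl_inj jg jg').
  have [_ [f jf ->]] := triangle_crossE tC xC eC wb je.
  by have [_ [f' jf' ->]] := triangle_crossE tC' xC' eC' wb je; rewrite (jl_inj jf jf').
case: ew => [je|[y je]].
  by rewrite (neighbours_block wb je) card_incident //; have [] := jlE je.
by have /subset_leq_card := neighbours_cross wb je; rewrite cards1 => /leq_trans->.
Qed.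

(** Triangles through the spoke of [x] correspond to the blocks joined to [x]; the edge from the hub
    to the block tells them apart. *)
Lemma spoke_lower x (ws : seq vertex) : uniq ws ->
  {in ws, forall w, [/\ w \in mvertices, block w & madj (elt x) w]} ->
  size ws <= #|triangles_of (sp x)|.
Proof.
move=> uws wsP; rewrite -(card_ord (size ws)) -cardsT.
pose R i C := [/\ triangle C, sp x \in C
  & exists2 f, jl f None (tnth (in_tuple ws) i) & f \in C].
apply: (@card_le_rel _ _ _ _ R) => [i _|i j C _ _ [tC xC [f jf fC]] [_ _ [g jg gC]]].
  have [wm wb xw] := wsP _ (mem_tnth i (in_tuple ws)).
  have [f [g [jf jg tC]]] := triangle_ex wm wb xw.
  exists [set sp x; f; g]; first by rewrite !inE tC eqxx.
  by split=> //; [rewrite !inE eqxx|exists f; rewrite // !inE eqxx orbT].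
have [_ ib _] := wsP _ (mem_tnth i (in_tuple ws)).
have [_ jb _] := wsP _ (mem_tnth j (in_tuple ws)).
have [f' jf' CE] := triangle_blockE tC xC fC ib jf.
move: gC; rewrite CE !inE eq_sym (negPf (sp_block x jb jg)).
rewrite (negPf (block_cross jb ib jg jf')) orbF /= => /eqP gf; rewrite gf in jg.
have tij : tnth (in_tuple ws) i = tnth (in_tuple ws) j.
  case: (joins_labels_ends jf jg) => -[] // jE.
  by rewrite -jE in jb.
move: tij; rewrite !(tnth_nth None) /= => /eqP.
by rewrite nth_uniq // => /eqP/val_inj.
Qed.

Lemma spoke_upper x (ws : seq vertex) :
  (forall w, w \in mvertices -> block w -> madj (elt x) w -> w \in ws) ->
  #|triangles_of (sp x)| <= size ws.
Proof.
move=> wsP; rewrite -(card_ord (size ws)) -[#|'I__|]cardsT.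
pose R C i := block (tnth (in_tuple ws) i) /\
  exists2 f, jl f None (tnth (in_tuple ws) i) & f \in C.
apply: (@card_le_rel _ _ _ _ R) => [C|C C' i].
  rewrite inE => /andP[tC xC].
  have [w [f [g [wb jf jg CE]]]] := triangle_spokeE tC xC.
  have [_ wm xw] := jlE jg; have /seq_tnthP[i wE] := wsP _ wm wb xw.
  by exists i; rewrite ?inE // /R -wE; split=> //; exists f; rewrite // CE !inE eqxx orbT.
rewrite !inE => /andP[tC xC] /andP[tC' xC'] [ib [f jf fC]] [_ [f' jf' fC']].
rewrite -(jl_inj jf jf') in fC'.
have [g jg ->] := triangle_blockE tC xC fC ib jf.
by have [g' jg' ->] := triangle_blockE tC' xC' fC' ib jf; rewrite (jl_inj jg jg').
Qed.

(* With [b.+2] pendants a spoke lies in more triangles than any other edge. *)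
Definition pendants x : seq vertex := [seq Some (d, nseq b.+1 x) | d <- iota 2 b.+2].

Lemma pendantsP x w : w \in pendants x ->
  [/\ w \in mvertices, block w & madj (elt x) w].
Proof.
case/mapP=> d; rewrite mem_iota => /andP[d2 dL] ->.
have db : block (Some (d, nseq b.+1 x)) by rewrite /=; lia.
rewrite mem_mvertices size_nseq eqxx andbT; split=> //.
have d0 : d == 0 = false by lia.
rewrite madj_elt //= d0 all_nseq /= eqxx ?orbT /=.
have -> : support (Some (d, x :: nseq b x)) = set0; last exact: set0_indep.
by apply/setP => i; rewrite !inE /= d0.
Qed.

Lemma pendants_uniq x : uniq (pendants x).
Proof. by rewrite map_inj_uniq ?iota_uniq // => ? ? []. Qed.

Lemma size_pendants x : size (pendants x) = b.+2.
Proof. by rewrite size_map size_iota. Qed.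

Lemma spoke_big x : b.+1 < #|triangles_of (sp x)|.
Proof.
by rewrite -(size_pendants x); apply: spoke_lower (pendants_uniq x) (@pendantsP x).
Qed.

Lemma spokeP e : reflect (exists x, e = sp x) (b.+1 < #|triangles_of e|).
Proof.
apply: (iffP idP) => [big|[x ->]]; last exact: spoke_big.
have [/existsP[x /eqP->]|/existsPn eN] := boolP [exists x, e == sp x]; first by exists x.
by move: big; rewrite ltnNge triangles_of_nonspoke.
Qed.

Lemma support_word t : support (Some (0, t)) = [set i in t].
Proof. by apply/setP => i; rewrite !inE. Qed.

(** The pendants of [x] always give [b.+2] triangles. If [x] is not a loop, the block constantly
    equal to [x] gives one more; if it is a loop, no block of kind 0 containing [x] has independent
    support. *)
Lemma nonloopP x : ([set x] \in indep M) = (b.+2 < #|triangles_of (sp x)|).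
Proof.
have sx (t : seq 'I_n) : t = nseq b.+1 x -> [set i in t] = [set x].
  by move=> ->; apply/setP => i; rewrite in_set mem_nseq in_set1.
apply/idP/idP => [xi|].
  rewrite -(size_pendants x) -[_.+1]/(size (Some (0, nseq b.+1 x) :: pendants x)).
  apply: spoke_lower => [|w].
    by rewrite cons_uniq pendants_uniq andbT; apply/mapP => -[d]; rewrite mem_iota => d2 [] d0; lia.
  rewrite inE => /predU1P[->|/pendantsP//].
  rewrite mem_mvertices size_nseq eqxx madj_elt // support_word sx //.
  by rewrite /= in_cons eqxx xi.
apply: contraLR => xd; rewrite -leqNgt -(size_pendants x); apply: spoke_upper.
move=> [[d t]|] //; rewrite mem_mvertices => /andP[dL /eqP szt] wb.
rewrite madj_elt //= => /andP[].
have [-> xt|d0 /all_pred1_nseq -> _] := eqVneq d 0.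
  rewrite support_word => /(@indep_sub _ M [set x]) xi; case/negP: xd; apply: xi.
  by rewrite sub1set inE.
by rewrite szt; apply: map_f; move: wb; rewrite /block mem_iota; lia.
Qed.

Lemma block_of S : S \in indep M -> S != set0 -> #|S| <= b.+1 ->
  exists e, (forall x, e != sp x) /\ neighbours e = S.
Proof.
move=> Si /set0Pn[x0 x0S] leS.
(* Entries of a block may repeat, so [S] is padded with copies of [x0] to length [b.+1]. *)
pose t := nseq (b.+1 - #|S|) x0 ++ enum S.
have tS : [set i in t] = S.
  apply/setP => i; rewrite !inE mem_cat mem_nseq mem_enum.
  by case: eqP => [->|_]; rewrite ?x0S ?andbF ?orbT.
have wm : Some (0, t) \in mvertices.
  by rewrite mem_mvertices size_cat size_nseq -cardE subnK ?eqxx.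
have hw : madj None (Some (0, t)).
  rewrite madj_hub support_word tS Si andbT; apply/existsP; exists x0.
  by rewrite /= -[_ \in t](in_set (mem t)) tS.
have [e je] := joins_labels_mk madj_sym madj_irr (mem_head None _ : None \in mvertices) wm hw.
exists e; split=> [x|]; first by rewrite eq_sym (sp_block x _ je).
by rewrite (neighbours_block _ je) //= -[RHS]tS.
Qed.

(** Pendants and edges between an element and a block give at most one neighbour. What remains is a
    hub edge to a block of kind 0, whose neighbours form its support. *)
Lemma neighbours_indep e : (forall x, e != sp x) -> 1 < #|neighbours e| ->
  neighbours e \in indep M.
Proof.
move=> eN nb; have [[x /eqP ex]|[w wb [je|[x je]]]] := edge_casesP e.
- by rewrite (negPf (eN x)) in ex.
- move: nb; rewrite (neighbours_block wb je).
  have [_ wm] := jlE je; rewrite madj_hub => /and3P[_ _].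
  case: w wb je wm => [[d t]|] //= _ _; rewrite mem_mvertices => /andP[_ /eqP szt].
  have [->|d0] := eqVneq d 0; first by rewrite support_word.
  move=> _ /card_gt1P[x [y []]]; rewrite !inE.
  move=> /all_pred1_nseq -> /all_pred1P/(congr1 (nth x ^~ 0)).
  by rewrite szt !size_nseq => /= ->; rewrite eqxx.
move: nb; have /subset_leq_card := neighbours_cross wb je.
by rewrite cards1 leqNgt => /negPf->.
Qed.

End MatroidGraph.

Definition matroid_graph b n (M : matroid 'I_n) : sgraph :=
  list_graph (mvertices b n) (madj_irr M).

Lemma spokes_ex b n (M : matroid 'I_n) :
  exists sp : 'I_n -> edge (matroid_graph b M), forall x, joins_labels (sp x) None (elt b x).
Proof.
apply: (@fin_all_exists _ (fun=> edge (matroid_graph b M))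
  (fun x e => joins_labels e None (elt b x))) => x.
apply: joins_labels_mk; rewrite ?mem_head ?elt_mem ?madj_hub_elt //.
exact: madj_sym.
Qed.

(** Singletons are treated apart, by counting triangles: a loop is also the only neighbour of some
    edge that is not a spoke, namely the hub edge of a pendant. Larger sets are carried over as
    neighbours of the edge given by [block_of]. *)
Lemma indep_imset b n1 n2 (M1 : matroid 'I_n1) (M2 : matroid 'I_n2)
    (sp1 : 'I_n1 -> edge (matroid_graph b M1)) (sp2 : 'I_n2 -> edge (matroid_graph b M2))
    (F : edge (matroid_graph b M1) -> edge (matroid_graph b M2)) G (f : 'I_n1 -> 'I_n2) g :
  (forall x, joins_labels (sp1 x) None (elt b x)) ->
  (forall x, joins_labels (sp2 x) None (elt b x)) ->
  cancel F G -> cancel G F -> cancel f g -> cancel g f ->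
  (forall x, F (sp1 x) = sp2 (f x)) ->
  (forall C : {set edge (matroid_graph b M1)}, triangle (F @: C) = triangle C) ->
  rank M1 <= b ->
  forall S, S \in indep M1 -> f @: S \in indep M2.
Proof.
move=> sp1P sp2P FK GK fK gK Fsp Ftri rM S Si.
have F_inj := can_inj FK; have f_inj := can_inj fK.
(* The rank bound makes [S] fit into a tuple of a block. *)
have leS : #|S| <= b.+1.
  by apply: leqW; apply: leq_trans rM; apply: (@leq_bigmax_cond _ _ (fun A : {set 'I_n1} => #|A|)).
have [->|S0] := eqVneq S set0; first by rewrite imset0 set0_indep.
have [S1|S1] := leqP #|S| 1.
  have /eqP/cards1P[x SE] : #|S| = 1 by apply/eqP; rewrite eqn_leq S1 card_gt0.
  rewrite SE imset_set1 (nonloopP sp2P) -Fsp.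
  by rewrite (card_triangles_of _ FK GK Ftri) -(nonloopP sp1P) -SE.
have [e [eN eS]] := block_of sp1P Si S0 leS.
have FeN y : F e != sp2 y.
  by rewrite -(gK y) -Fsp (inj_eq F_inj).
have FeS : neighbours sp2 (F e) = f @: S.
  apply/setP => y; rewrite -(gK y) mem_imset // -eS.
  apply/neighboursP/neighboursP => -[C [tC eC xC]].
    exists (G @: C); rewrite -Ftri can_imset_id //.
    by rewrite -[e]FK -[sp1 _]FK Fsp !imset_f.
  by exists (F @: C); rewrite Ftri -Fsp !imset_f.
by rewrite -FeS (neighbours_indep sp2P FeN) // FeS card_imset.
Qed.

Lemma spoke_map b n1 n2 (M1 : matroid 'I_n1) (M2 : matroid 'I_n2)
    (sp1 : 'I_n1 -> edge (matroid_graph b M1)) (sp2 : 'I_n2 -> edge (matroid_graph b M2))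
    (F : edge (matroid_graph b M1) -> edge (matroid_graph b M2)) G :
  (forall x, joins_labels (sp1 x) None (elt b x)) ->
  (forall x, joins_labels (sp2 x) None (elt b x)) ->
  cancel F G -> cancel G F ->
  (forall C : {set edge (matroid_graph b M1)}, triangle (F @: C) = triangle C) ->
  exists f : 'I_n1 -> 'I_n2, forall x, F (sp1 x) = sp2 (f x).
Proof.
move=> sp1P sp2P FK GK Ftri.
apply: (@fin_all_exists _ (fun=> 'I_n2) (fun x y => F (sp1 x) = sp2 y)) => x.
apply/(spokeP sp2P); rewrite (card_triangles_of _ FK GK Ftri).
exact: spoke_big.
Qed.

Lemma matroid_iso_of_graph b n1 n2 (M1 : matroid 'I_n1) (M2 : matroid 'I_n2) :
  rank M1 <= b -> rank M2 <= b ->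
  matroid_iso (cycle_matroid (matroid_graph b M1)) (cycle_matroid (matroid_graph b M2)) ->
  matroid_iso M1 M2.
Proof.
move=> r1 r2 [F [G FK GK] Fc].
have [sp1 sp1P] := spokes_ex b M1; have [sp2 sp2P] := spokes_ex b M2.
have Ftri (C : {set edge (matroid_graph b M1)}) : triangle (F @: C) = triangle C.
  rewrite /triangle card_imset; last exact: can_inj FK.
  by congr (_ && _); apply/idP/idP => /Fc.
have Gtri (C : {set edge (matroid_graph b M2)}) : triangle (G @: C) = triangle C.
  by rewrite -Ftri can_imset_id.
have [f fP] := spoke_map sp1P sp2P FK GK Ftri.
have [g gP] := spoke_map sp2P sp1P GK FK Gtri.
have fK : cancel f g by move=> x; apply: (sp_inj sp1P); rewrite -gP -fP FK.
have gK : cancel g f by move=> x; apply: (sp_inj sp2P); rewrite -fP -gP GK.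
apply/matroid_isoP; exists f; first by exists g.
move=> A; apply/idP/idP => iA; last exact: indep_imset sp1P sp2P FK GK fK gK fP Ftri r1 A iA.
by have := indep_imset sp2P sp1P GK FK gK fK gP Gtri r2 iA; rewrite can_imset_id.
Qed.

(** * From isomorphic matroids to isomorphic graphs *)

Lemma incident_map (A B : eqType) (f : A -> B) u a : injective f ->
  incident (vertex_map f u) (f a) = incident u a.
Proof.
move=> f_inj; case: u => [[c t]|] //=; rewrite mem_map // all_map.
by congr (if _ then _ else _); apply: eq_all => y /=; rewrite inj_eq.
Qed.

Lemma queried_map (A B : eqType) (f : A -> B) u a : injective f ->
  queried (vertex_map f u) (f a) = queried u a.
Proof. by move=> f_inj; case: u => [[c t]|] //=; rewrite mem_map. Qed.

Lemma vertex_map_fst (A B : Type) (f : A -> B) u : omap fst (vertex_map f u) = omap fst u.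
Proof. by case: u. Qed.

Lemma madj_map n1 n2 (M1 : matroid 'I_n1) (M2 : matroid 'I_n2) f g :
  cancel f g -> cancel g f ->
  (forall A : {set 'I_n1}, (f @: A \in indep M2) = (A \in indep M1)) ->
  forall u v, madj M2 (vertex_map f u) (vertex_map f v) = madj M1 u v.
Proof.
move=> fK gK fP u v; have f_inj := can_inj fK.
rewrite /madj !vertex_map_fst; congr (_ && _).
  apply/existsP/existsP => -[i].
    by rewrite -{1 2}(gK i) !incident_map //; exists (g i).
  by exists (f i); rewrite !incident_map.
rewrite -fP; set S := [set i | _].
suff -> : S = f @: [set i | queried u i || queried v i] by [].
by apply/setP => i; rewrite -(gK i) mem_imset // !inE !queried_map.
Qed.

(** Applying the bijection to every entry of every tuple is already an isomorphism of graphs. *)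
Lemma graph_iso_of_matroid b n1 n2 (M1 : matroid 'I_n1) (M2 : matroid 'I_n2) :
  matroid_iso M1 M2 ->
  matroid_iso (cycle_matroid (matroid_graph b M1)) (cycle_matroid (matroid_graph b M2)).
Proof.
move=> /matroid_isoP[f [g fK gK] fP].
have f_inj := can_inj fK.
have mapK (A B : Type) (p : A -> B) q : cancel p q -> cancel (vertex_map p) (vertex_map q).
  by move=> pK [[c t]|] //=; rewrite mapK.
have map_mem (n n' : nat) (p : 'I_n -> 'I_n') :
    {in mvertices b n, forall v, vertex_map p v \in mvertices b n'}.
  by move=> [[c t]|] // ; rewrite !mem_mvertices size_map.
apply: (@list_graph_matroid_iso _ _ _ _ _ _ (mvertices_uniq b n1)
  (mvertices_uniq b n2) (madj_sym M1) (madj_sym M2) _ _ (vertex_map f) (vertex_map g)) => //.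
- exact: mapK.
- exact: mapK.
- exact: map_mem.
- exact: map_mem.
exact: madj_map fK gK fP.
Qed.

(** * The reduction *)

Section Correctness.
Variables (b : nat) (x : matroid_pair b).

Definition ground_size (s : bool) : nat := if s then size2 x else size1 x.

Definition side_matroid s : matroid 'I_(ground_size s) :=
  if s return matroid 'I_(ground_size s) then matroid2 x else matroid1 x.

Lemma pair_oracleE s v : pair_oracle x (s :: v) = indep_oracle (side_matroid s) v.
Proof. by case: s. Qed.

Lemma adj_bitE s u v :
  adj_bit (pair_oracle x) ground_size s (vertex_map val u) (vertex_map val v) =
  madj (side_matroid s) u v.
Proof.
rewrite /adj_bit /madj !vertex_map_fst -val_enum_ord has_map.
rewrite pair_oracleE /indep_oracle 2!size_map size_enum_ord eqxx andTb.
have -> : [set i : 'I_(ground_size s) | nth false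
    [seq queried (vertex_map val u) i || queried (vertex_map val v) i
       | i <- [seq val i | i <- enum 'I_(ground_size s)]] i] =
    [set i | queried u i || queried v i].
  apply/setP => i; rewrite !inE -map_comp (nth_map i) ?size_enum_ord //.
  by rewrite nth_ord_enum /= !queried_map //; exact: val_inj.
congr (_ && _).
have iE (w : option (nat * seq 'I_(ground_size s))) i :
  incident (vertex_map val w) (val i) = incident w i by apply/incident_map/val_inj.
apply/hasP/existsP => [[i _]|[i uv]]; first by rewrite /= !iE; exists i.
by exists i; rewrite ?mem_enum //= !iE.
Qed.

(** The machine meets the vertices in the order of [mvertices], with each element replaced by its
    number. *)
Lemma graph_wordE s :
  graph_word b b.+4 (pair_oracle x) ground_size s =
  encode_graph (matroid_graph b (side_matroid s)).
Proof.
rewrite encode_list_graph; last exact: madj_sym.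
rewrite /graph_word -val_enum_ord map_vertices size_map allpairs_mapl allpairs_mapr.
congr (_ ++ flatten _); apply: eq_map => u; apply: eq_map => v.
exact: adj_bitE.
Qed.

End Correctness.

Theorem theorem6 : forall b : nat, poly_reducible (MI b) GMI.
Proof.
move=> b; pose J := (bool * 'I_b.+1)%type.
exists (machine_of (In J) (Qry J) (Out J) (reduction b b.+4)), (reduction_cost b b.+4) => x.
pose N := size (oencode (o := MI b) x).
have n_le s : ground_size x s <= N.
  by rewrite /N /= size_cat /unary !size_rcons !size_nseq; case: s; rewrite /=; lia.
have [T [t [eT le_t oT]]] := exec_reduction b b.+4 (pair_oracle x) n_le.
exists t, (matroid_graph b (matroid1 x), matroid_graph b (matroid2 x)); split=> //.
  have := @exec_halts_with _ (In _) _ (Out _) _ _ _ _ _ eT.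
  by rewrite oT !graph_wordE.
split; first exact: graph_iso_of_matroid.
exact: matroid_iso_of_graph (rank1 x) (rank2 x).
Qed.
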